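(* Let $b$ and $c$ be positive real numbers, consider the scalar equation $u''(t)+cu'(t)+bu(t)=f(t)$, and let $K(b,c)$ be its optimal velocity bound (defined in the context). Set $$\Delta:=\left|1-\frac{4b}{c^2}\right|^{1/2}.$$ Then $$K(b,c)=\begin{cases}\dfrac{2}{\sqrt b}\left(\dfrac{1-\Delta}{1+\Delta}\right)^{1/(2\Delta)} & \text{if }4b<c^2,\\[2ex] \dfrac{4}{ec} & \text{if }4b=c^2,\\[2ex] \dfrac{2}{\sqrt b}\left\{1-\exp\left(-\dfrac{\pi}{\Delta}\right)\right\}^{-1}\exp\left(-\dfrac{\arctan\Delta}{\Delta}\right) & \text{if }4b>c^2.\end{cases}$$ As a consequence, the function $K(b,c)$ has the following properties. - For every $c>0$, the function $b\mapsto K(b,c)$ is strictly decreasing on $(0,+\infty)$. - For every $b>0$, the function $c\mapsto K(b,c)$ is strictly decreasing on $(0,+\infty)$. - One has $$\frac{4}{\pi c}<K(b,c)<\frac{2}{c}\qquad\forall (b,c)\in(0,+\infty)^2,$$ and the constants $2$ and $4/\pi$ are optimal (the constant $2$ cannot be replaced by a smaller one, and the constant $4/\pi$ cannot be replaced by a larger one).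
   Context: The optimal velocity bound $K(b,c)$ is the smallest constant $K$ such that $$\limsup_{t\to+\infty}|u'(t)|\le K\limsup_{t\to+\infty}|f(t)|$$ for every $f:(0,+\infty)\to\mathbb{R}$ that is integrable on $(0,T)$ for every $T>0$ and satisfies $\limsup_{t\to+\infty}|f(t)|<+\infty$, and for every solution $u$ of $u''+cu'+bu=f$ on $(0,+\infty)$; here $\limsup_{t\to+\infty}|f(t)|:=\lim_{T\to+\infty}\|f\|_{L^\infty((T,+\infty))}$. This constant coincides with the smallest $K$ such that $|u'(t)|\le K\|f\|_{L^\infty(\mathbb{R})}$ for all $t\in\mathbb{R}$ (equivalently, only for $t=0$) and all $f\in L^\infty(\mathbb{R},\mathbb{R})$, where $u$ is the unique solution of $u''+cu'+bu=f$ on $\mathbb{R}$ that is bounded on the whole real line; it also coincides with the constants obtained by restricting the latter to periodic $f$. *)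

(* Defs.v *)
From mathcomp Require Export all_boot all_order all_algebra.
From mathcomp Require Export all_classical all_reals all_analysis.

Set Implicit Arguments.
Unset Strict Implicit.
Unset Printing Implicit Defensive.

Export Order.TTheory GRing.Theory Num.Theory.
Export numFieldNormedType.Exports.

Local Open Scope classical_set_scope.
Local Open Scope ring_scope.

(* Functions on (0, +oo) are encoded as total functions R -> R whose values on
   (-oo, 0] play no role. *)
Section VelocityBound.
Context {R : realType}.
Implicit Types (b c K : R) (f u v w : R -> R).

Local Notation mu := (@lebesgue_measure R).

(* ||f||_{L^oo((T, +oo))} *)
Definition tail_Linfty_norm f (T : R) : \bar R :=
  'N[mu]_+oo%E[EFin \o (f \_ `]T, +oo[)].

(* This depends only on the a.e. class of f, unlike limf_esup. *)
Definition ess_limsup_abs f : \bar R :=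
  lim (tail_Linfty_norm f T @[T --> +oo]).

Definition limsup_abs v : \bar R :=
  limf_esup (fun t => `|v t|%:E) (+oo%R : set_system R).

Definition admissible_forcing f : Prop :=
  (forall T : R, 0 < T -> mu.-integrable `]0, T[ (EFin \o f)) /\
  (ess_limsup_abs f < +oo)%E.

(* v is locally absolutely continuous on (0, +oo), with derivative the locally
   integrable function w. *)
Definition is_primitive v w : Prop :=
  forall s t : R, 0 < s -> s <= t ->
    mu.-integrable `[s, t] (EFin \o w) /\
    v t - v s = \int[mu]_(r in `[s, t]) w r.

(* Caratheodory (equivalently W^{2,1}_loc) solution of u'' + c u' + b u = f on
   (0, +oo): w is the second derivative u'', an element of L^1_loc, and the
   equation holds almost everywhere. *)
Definition is_solution b c f u : Prop :=
  (forall t : R, 0 < t -> derivable u t 1) /\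
  exists w : R -> R,
    is_primitive (derive1 u) w /\
    {ae mu, forall t : R, 0 < t -> w t + c * derive1 u t + b * u t = f t}.

Definition velocity_bound b c K : Prop :=
  forall f u, admissible_forcing f -> is_solution b c f u ->
    (limsup_abs (derive1 u) <= K%:E * ess_limsup_abs f)%E.

Definition optimal_velocity_bound b c : R :=
  inf [set K : R | velocity_bound b c K].

End VelocityBound.

(* Main.v *)
Require Import Defs.
From mathcomp Require Import measurable_realfun ess_sup_inf ring lra.

(* Let G be the solution of G'' + c G' + b G = 0 with G(0) = 0 and G'(0) = 1.  The
   optimal bound is K(b, c) = int_0^oo |G'|, the total variation of G on [0, +oo).

   Upper bound: for a C^2 function v, G'(t - s) v'(s) - b G(t - s) v(s) has
   derivative G'(t - s) (v'' + c v' + b v)(s), so on each interval where G(t - .) is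
   monotone its increment is at most sup |v'' + c v' + b v| times that of G.  This
   only uses the mean value theorem; it passes to a Caratheodory solution u by
   applying it to the averages (1/h) int_s^(s+h) u, which are C^2, and letting h tend
   to 0.

   Lower bound: a square wave switching sign so as to follow the sign of G'(t - .) at
   arbitrarily large t.  The corresponding solution is a superposition of translates
   of the step response, and its derivative a superposition of translates of G.

   Since G' vanishes once (overdamped, critical) or periodically (underdamped), the
   variation is explicit.  Up to a factor 4/c or 2/sqrt b, K is a function of
   p = 4b/c^2 and of Delta = |1 - p|^(1/2); all monotonicity claims follow from the
   sign of its logarithmic derivative.  The only delicate case is the underdamped one
   at fixed c, where the sign of atan(pi/x) - pi/x + pi/(e^x - 1) is required: its
   derivative has the sign of cosh x - 1 - x^2/2 - x^4/(2 pi^2), which changes from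
   negative to positive just once, and it tends to 0 at both ends of (0, +oo). *)

Set Implicit Arguments.
Unset Strict Implicit.
Unset Printing Implicit Defensive.

Local Open Scope classical_set_scope.
Local Open Scope ring_scope.

(** * Differentiation *)

Section Derivatives.
Context {R : realType}.
Implicit Types (f g df : R -> R) (x a b : R).

Lemma is_derive_addf f g x a b : is_derive x 1 f a -> is_derive x 1 g b ->
  is_derive x 1 (fun t => f t + g t) (a + b).
Proof. exact: is_deriveD. Qed.

Lemma is_derive_oppf f x a : is_derive x 1 f a ->
  is_derive x 1 (fun t => - f t) (- a).
Proof. exact: is_deriveN. Qed.

Lemma is_derive_mulf f g x a b : is_derive x 1 f a -> is_derive x 1 g b ->
  is_derive x 1 (fun t => f t * g t) (f x * b + g x * a).
Proof. by move=> fa gb; apply: is_derive_eq. Qed.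

Lemma is_derive_compf f g x a b : is_derive (g x) 1 f a ->
  is_derive x 1 g b -> is_derive x 1 (fun t => f (g t)) (b * a).
Proof. by move=> fa gb; rewrite mulrC; exact: is_derive1_comp. Qed.

Lemma is_derive_expf f x a n : is_derive x 1 f a ->
  is_derive x 1 (fun t => f t ^+ n) (n%:R * f x ^+ n.-1 * a).
Proof.
move=> fa; case: n => [|n].
  by rewrite !mul0r; under eq_fun do rewrite expr0; exact: is_derive_cst.
have -> : (fun t => f t ^+ n.+1) = (f ^+ n.+1).
  by apply/funext => t; elim: n.+1 => [|m IH]; rewrite ?expr0// !exprS IH.
by apply: is_derive_eq; rewrite -mulr_natl.
Qed.

Lemma is_derive_invf f x a : f x != 0 -> is_derive x 1 f a ->
  is_derive x 1 (fun t => (f t)^-1) (- (f x) ^- 2 * a).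
Proof. by move=> fx fa; apply: is_derive_eq. Qed.

Lemma is_derive_continuous f x a : is_derive x 1 f a -> {for x, continuous f}.
Proof.
by move=> [df _]; apply: differentiable_continuous; exact/derivable1_diffP.
Qed.

Lemma mean_value f df x y : x < y ->
  (forall z, x <= z <= y -> is_derive z 1 f (df z)) ->
  exists2 z, x < z < y & f y - f x = df z * (y - x).
Proof.
move=> xy dfP.
have cf : {within `[x, y], continuous f}.
  apply: continuous_in_subspaceT => z; rewrite inE /= in_itv => zi.
  exact: is_derive_continuous (dfP _ zi).
have df_oo z : z \in `]x, y[ -> is_derive z 1 f (df z).
  by rewrite in_itv => /andP[? ?]; apply: dfP; rewrite !ltW.
have [z zi ->] := MVT xy df_oo cf.
by exists z => //; move: zi; rewrite in_itv.
Qed.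

Lemma derive_gt0_lt f df x y : x < y ->
  (forall z, x <= z <= y -> is_derive z 1 f (df z)) ->
  (forall z, x < z < y -> 0 < df z) -> f x < f y.
Proof.
move=> xy fP df0; have [z zi E] := mean_value xy fP.
by rewrite -subr_gt0 E mulr_gt0 ?subr_gt0// df0.
Qed.

Lemma derive_ge0_le f df x y : x <= y ->
  (forall z, x <= z <= y -> is_derive z 1 f (df z)) ->
  (forall z, x < z < y -> 0 <= df z) -> f x <= f y.
Proof.
rewrite le_eqVlt => /predU1P[->//|xy] fP df0.
have [z zi E] := mean_value xy fP.
by rewrite -subr_ge0 E mulr_ge0 ?subr_ge0 ?df0// ltW.
Qed.

End Derivatives.

(* [notypeclasses] keeps type class resolution from filling the derivative with
   scalings [_ *: _], which [ring] and [field] do not understand. *)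
Ltac der := match goal with
 | |- is_derive _ _ (fun t => t) _ => exact: is_derive_id
 | |- is_derive _ _ (fun t => ?a) _ => exact: is_derive_cst
 | |- is_derive _ _ (fun t => @GRing.add _ (@?f t) (@?g t)) _ =>
     notypeclasses refine (@is_derive_addf _ f g _ _ _ _ _); der
 | |- is_derive _ _ (fun t => @GRing.opp _ (@?f t)) _ =>
     notypeclasses refine (@is_derive_oppf _ f _ _ _); der
 | |- is_derive _ _ (fun t => @GRing.mul _ (@?f t) (@?g t)) _ =>
     notypeclasses refine (@is_derive_mulf _ f g _ _ _ _ _); der
 | |- is_derive _ _ (fun t => @GRing.exp _ (@?f t) _) _ =>
     notypeclasses refine (@is_derive_expf _ f _ _ _ _); der
 | |- is_derive _ _ (fun t => @GRing.inv _ (@?f t)) _ =>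
     notypeclasses refine (@is_derive_invf _ f _ _ _ _); [|der]
 | |- is_derive _ _ (fun t => expR (@?g t)) _ =>
     notypeclasses refine (@is_derive_compf _ _ g _ _ _ (is_derive_expR _) _); der
 | |- is_derive _ _ (fun t => sin (@?g t)) _ =>
     notypeclasses refine (@is_derive_compf _ _ g _ _ _ (is_derive_sin _) _); der
 | |- is_derive _ _ (fun t => cos (@?g t)) _ =>
     notypeclasses refine (@is_derive_compf _ _ g _ _ _ (is_derive_cos _) _); der
 | |- is_derive _ _ (fun t => atan (@?g t)) _ =>
     notypeclasses refine (@is_derive_compf _ _ g _ _ _ (is_derive1_atan _) _); der
 | |- is_derive _ _ (fun t => ln (@?g t)) _ =>
     notypeclasses refine (@is_derive_compf _ _ g _ _ _ (is_derive1_ln _) _); [|der]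
 | _ => cbv beta
 end.
Ltac derE := notypeclasses refine (is_derive_eq _ _); [der..|cbv beta].

(** * Monotonicity of the explicit bounds *)

Section SignCrossing.
Context {R : realType}.
Implicit Types (f g : R -> R) (x y : R).

Definition up_crossing f := forall x y, 0 < x -> x < y -> 0 <= f x -> 0 < f y.

(** If [f x >= 0], the mean value theorem on [[0, x]] gives an earlier point where [g >= 0]; from
    there on [g > 0], so [f] increases past [x]. *)
Lemma up_crossing_primitive f g : f 0 = 0 ->
  (forall x, is_derive x 1 f (g x)) -> up_crossing g -> up_crossing f.
Proof.
move=> f0 fg ug x y x0 xy fx.
have [z /andP[z0 zx]] := mean_value x0 (fun t _ => fg t).
rewrite f0 !subr0 => E.
have gz : 0 <= g z by rewrite E pmulr_lge0 in fx.
apply: le_lt_trans fx _; apply: (derive_gt0_lt xy (fun t _ => fg t)) => t /andP[xt _].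
by apply: ug z0 _ gz; apply: lt_trans xt.
Qed.

Definition cosh_gap x := (expR x + expR (- x)) / 2 - 1 - x ^+ 2 / 2 - x ^+ 4 / (2 * pi ^+ 2).

(** The fourth derivative, [cosh x - 12 / pi^2], increases on the positive axis, while the function
    and its first three derivatives vanish at 0; the crossing property thus lifts through four
    integrations. *)
Lemma up_crossing_cosh_gap : up_crossing cosh_gap.
Proof.
rewrite /cosh_gap; have : pi != 0 :> R by rewrite gt_eqF// pi_gt0.
move: pi => p p0.
pose sh x : R := (expR x - expR (- x)) / 2.
pose ch x : R := (expR x + expR (- x)) / 2.
have dsh x : is_derive x 1 sh (ch x) by rewrite /sh /ch; derE; field.
have dch x : is_derive x 1 ch (sh x) by rewrite /sh /ch; derE; field.
have sh0 : sh 0 = 0 by rewrite /sh oppr0 subrr mul0r.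
have ch0 : ch 0 = 1 by rewrite /ch oppr0 expR0; field.
have u4 : up_crossing (fun x => ch x - 12 / p ^+ 2).
  move=> x y x0 xy h; apply: le_lt_trans h _; rewrite ltrD2r.
  apply: (derive_gt0_lt xy (fun t _ => dch t)) => z /andP[xz _].
  by rewrite /sh divr_gt0// subr_gt0 ltr_expR gtrN// (lt_trans x0).
have u3 : up_crossing (fun x => sh x - 12 * x / p ^+ 2).
  apply: up_crossing_primitive u4; first by rewrite sh0; ring.
  by move=> x; derE; [exact: dsh|field].
have u2 : up_crossing (fun x => ch x - 1 - 6 * x ^+ 2 / p ^+ 2).
  apply: up_crossing_primitive u3; first by rewrite ch0; ring.
  by move=> x; derE; [exact: dch|field].
have u1 : up_crossing (fun x => sh x - x - 2 * x ^+ 3 / p ^+ 2).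
  apply: up_crossing_primitive u2; first by rewrite sh0; ring.
  by move=> x; derE; [exact: dsh|field].
apply: up_crossing_primitive u1; first by rewrite -/(ch 0) ch0; ring.
by move=> x; rewrite /sh; derE; field.
Qed.

End SignCrossing.

(** * Sign of the derivative in the underdamped case *)

Section UnderdampedProfile.
Context {R : realType}.
Implicit Types x y d t : R.

Lemma expR_gt_quadratic x : 0 < x -> 1 + x + x ^+ 2 / 2 < expR x.
Proof.
move=> x0; have dP (t : R) : is_derive t 1 (fun s : R => expR s - s - s ^+ 2 / 2) (expR t - 1 - t).
  by derE; field.
have := derive_gt0_lt x0 (fun t _ => dP t).
rewrite expR0; move=> H.
have : 1 - 0 - 0 ^+ 2 / 2 < expR x - x - x ^+ 2 / 2.
  by apply: H => z /andP[z0 _]; have := @expR_gt1Dx R z; rewrite gt_eqF// => /(_ isT); lra.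
by lra.
Qed.

Lemma atan_lt x : 0 < x -> atan x < x.
Proof.
move=> x0; have dP (t : R) : is_derive t 1 (fun s : R => s - atan s) (1 - (1 + t ^+ 2)^-1).
  by derE; ring.
have : 0 - atan 0 < x - atan x.
  apply: (derive_gt0_lt x0 (fun t _ => dP t)) => z /andP[z0 _].
  by rewrite subr_gt0 invf_lt1 ?ltrDl ?exprn_gt0// addr_gt0// exprn_gt0.
by rewrite atan0; lra.
Qed.

Lemma atan_gt x : 0 < x -> x / (1 + x ^+ 2) < atan x.
Proof.
move=> x0.
have p t : 0 < 1 + t ^+ 2 by have := sqr_ge0 t; lra.
have dP (t : R) : is_derive t 1 (fun s : R => atan s - s / (1 + s ^+ 2))
    (2 * t ^+ 2 / (1 + t ^+ 2) ^+ 2).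
  by derE; rewrite ?gt_eqF//; field; rewrite gt_eqF.
have : atan 0 - 0 / (1 + 0 ^+ 2) < atan x - x / (1 + x ^+ 2).
  apply: (derive_gt0_lt x0 (fun t _ => dP t)) => z /andP[z0 _].
  by rewrite divr_gt0 ?exprn_gt0// mulr_gt0// exprn_gt0.
by rewrite atan0 mul0r; lra.
Qed.

(* [coth_atan_gap (pi / d) / d ^+ 2] is the derivative of [under_c] at [d]. *)
Definition coth_atan_gap x := atan (pi / x) - pi / x + pi / (expR x - 1).

Lemma expR_sub1_gt0 x : 0 < x -> 0 < expR x - 1.
Proof. by move=> x0; rewrite subr_gt0 expR_gt1. Qed.

(** The derivative of [atan (pi / x) - pi / x] is [pi / P], and that of the last term is
    [- pi / (P + 2 * cosh_gap x)], because [P + 2 * cosh_gap x = 2 cosh x - 2]. *)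
Lemma is_derive_coth_atan_gap x : 0 < x ->
  let P := x ^+ 2 * (x ^+ 2 + pi ^+ 2) / pi ^+ 2 in
  0 < P /\ 0 < P + 2 * cosh_gap x /\
  is_derive x 1 coth_atan_gap (2 * pi * cosh_gap x / (P * (P + 2 * cosh_gap x))).
Proof.
rewrite /coth_atan_gap /cosh_gap => x0; have : 0 < pi :> R := pi_gt0 R.
move: pi => p pi0; cbv zeta.
set P := x ^+ 2 * _ / _; set Q := (X in P + 2 * X).
have P0 : 0 < P.
  by rewrite /P divr_gt0 ?exprn_gt0// mulr_gt0 ?exprn_gt0// addr_gt0// exprn_gt0.
have e0 := expR_sub1_gt0 x0.
have PQ : P + 2 * Q = (expR x - 1) ^+ 2 / expR x.
  rewrite /P /Q expRN; field.
  by rewrite !gt_eqF// expR_gt0.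
split => //; split; first by rewrite PQ divr_gt0 ?expR_gt0// exprn_gt0.
have -> : 2 * p * Q / (P * (P + 2 * Q)) = p / P - p / (P + 2 * Q).
  by field; rewrite PQ !gt_eqF// divr_gt0 ?expR_gt0// exprn_gt0.
rewrite PQ ; derE; rewrite ?gt_eqF// /P.
field; rewrite !gt_eqF ?expR_gt0//.
all: nra.
Qed.

(** A nonnegative value at [x] would be carried to one end of the half-line, where the function
    tends to 0: to infinity if [cosh_gap] is nonnegative somewhere before [x], to 0 otherwise. *)
Lemma coth_atan_gap_lt0 x : 0 < x -> coth_atan_gap x < 0.
Proof.
move=> x0; rewrite ltNge; apply/negP => Fx.
have pi0 : 0 < pi :> R := pi_gt0 R.
pose dF (x : R) := let P := x ^+ 2 * (x ^+ 2 + pi ^+ 2) / pi ^+ 2 in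
  2 * pi * cosh_gap x / (P * (P + 2 * cosh_gap x)).
have dFP y z : 0 < y -> forall t, y <= t <= z -> is_derive t 1 coth_atan_gap (dF t).
  move=> y0 t /andP[yt _]; have t0 : 0 < t by apply: lt_le_trans yt.
  by have [_ [_ H]] := is_derive_coth_atan_gap t0; exact: H.
have dF_gt0 t : 0 < t -> 0 < cosh_gap t -> 0 < dF t.
  move=> t0 ct; have [P0 [PQ0 _]] := is_derive_coth_atan_gap t0.
  by apply: divr_gt0; apply: mulr_gt0 => //; exact: mulr_gt0.
have dF_lt0 t : 0 < t -> cosh_gap t < 0 -> dF t < 0.
  move=> t0 ct; have [P0 [PQ0 _]] := is_derive_coth_atan_gap t0.
  have h : 0 < 2 * pi :> R by exact: mulr_gt0.
  rewrite /dF pmulr_llt0; first by rewrite pmulr_rlt0.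
  by rewrite invr_gt0; apply: mulr_gt0.
have [[z /andP[z0 zx] cz]|nz] := pselect (exists2 z, 0 < z < x & 0 <= cosh_gap z).
  have incr y w : x <= y -> y < w -> coth_atan_gap y < coth_atan_gap w.
    move=> xy yw; have y0 : 0 < y by apply: lt_le_trans xy.
    apply: (derive_gt0_lt yw (dFP _ _ y0)) => t /andP[yt _].
    apply: dF_gt0; first exact: lt_trans yt.
    apply: (up_crossing_cosh_gap z0 _ cz).
    by apply: lt_trans yt; apply: lt_le_trans xy.
  have F1 : 0 < coth_atan_gap (x + 1) by apply: le_lt_trans Fx (incr _ _ _ _); rewrite ?ltrDl.
  set e := coth_atan_gap (x + 1) in F1.
  (* Since [expR w - 1 >= w >= pi / e] and [atan (pi / w) < pi / w], the value at this [w] is below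
     [e], against the growth from [x + 1]. *)
  pose w := x + 1 + pi / e.
  have w0 : 0 < w by rewrite /w !addr_gt0// divr_gt0.
  have : e < coth_atan_gap w.
    by apply: incr; rewrite ?lerDl ?ltrDl ?divr_gt0.
  apply/negP; rewrite -leNgt /coth_atan_gap.
  have h1 : atan (pi / w) < pi / w by rewrite atan_lt// divr_gt0.
  suff : pi / (expR w - 1) <= e by lra.
  rewrite ler_pdivrMr ?expR_sub1_gt0// -ler_pdivrMl//.
  have := expR_ge1Dx w; rewrite mulrC {1}/w; lra.
have decr y w : 0 < y -> y < w -> w <= x -> coth_atan_gap w < coth_atan_gap y.
  move=> y0 yw wx; rewrite -ltrN2.
  apply: (@derive_gt0_lt _ (fun t => - coth_atan_gap t) (fun t => - dF t) _ _ yw) => t.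
    by move=> ti; apply: is_derive_oppf; exact: dFP ti.
  move=> /andP[yt tw]; have t0 := lt_trans y0 yt.
  rewrite oppr_gt0 dF_lt0// ltNge; apply/negP => ct; apply: nz.
  by exists t => //; rewrite t0 (lt_le_trans tw).
have F2 : 0 < coth_atan_gap (x / 2) by apply: le_lt_trans Fx (decr _ _ _ _ _); lra.
set e := coth_atan_gap (x / 2) in F2.
(* Near 0 the value at [w] is at most [w * pi], by [atan < pi / 2] and the quadratic lower bound on
   [expR]; so [w <= e / pi] contradicts the decrease up to [x / 2]. *)
pose w := Num.min (x / 4) (e / pi).
have w0 : 0 < w by rewrite lt_min !divr_gt0.
have wx : w <= x / 4 by rewrite ge_min lexx.
have we : w * pi <= e by rewrite -ler_pdivlMr// ge_min lexx orbT.
have : e < coth_atan_gap w by apply: decr => //; lra.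
apply/negP; rewrite -leNgt; apply: le_trans we.
rewrite /coth_atan_gap.
have h1 := atan_ltpi2 (pi / w).
have h2 : (expR w - 1)^-1 <= w^-1 - (2 + w)^-1.
  have -> : w^-1 - (2 + w)^-1 = (w + w ^+ 2 / 2)^-1 by field;
    apply/andP; split; [|apply/andP; split]; rewrite gt_eqF//; nra.
  have := expR_gt_quadratic w0 => h; rewrite lef_pV2 ?posrE ?expR_sub1_gt0//; first lra.
  by rewrite addr_gt0// divr_gt0// exprn_gt0.
have h3 : pi / (expR w - 1) <= pi / w - pi / (2 + w) by rewrite -mulrBr ler_pM2l.
have h4 : pi / 2 - pi / (2 + w) <= w * pi.
  have -> : pi / 2 - pi / (2 + w) = w * pi / (2 * (2 + w)) by field; lra.
  rewrite ler_piMr ?mulr_ge0 ?ltW// invf_lt1; lra.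
lra.
Qed.

End UnderdampedProfile.

(** * Monotonicity and limits of the profiles in Delta *)

Section Profiles.
Context {R : realType}.
Implicit Types x y d t e : R.

(** This is [1 - q], with [q] the factor by which the amplitude of an underdamped [G] drops over
    half a period. *)
Definition osc_ratio d := 1 - expR (- (pi / d)).

(** Logarithm of [K sqrt b / 2] in terms of Delta, suited to fixed [b]; [under_c] below is the
    logarithm of [K c / 4], suited to fixed [c]. They differ by half of [ln (4 b / c^2)]. *)
Definition under_b d := - ln (osc_ratio d) - atan d / d.

Definition under_c d := under_b d - ln (1 + d ^+ 2) / 2.

Lemma osc_ratio_gt0 d : 0 < d -> 0 < osc_ratio d.
Proof. by move=> d0; rewrite subr_gt0 expR_lt1 oppr_lt0 divr_gt0// pi_gt0. Qed.

Lemma osc_ratio_lt d t : 0 < d -> d < t -> osc_ratio t < osc_ratio d.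
Proof.
move=> d0 dt; rewrite ltrD2l ltrN2 ltr_expR ltrN2 ltr_pM2l ?pi_gt0//.
by rewrite ltf_pV2// posrE// (lt_trans d0).
Qed.

Lemma atan_div_lt x y : 0 < x -> x < y -> atan y / y < atan x / x.
Proof.
move=> x0 xy; rewrite -ltrN2.
apply: (@derive_gt0_lt _ (fun t => - (atan t / t))
  (fun t => (atan t - t / (1 + t ^+ 2)) / t ^+ 2) _ _ xy) => z /andP[xz _].
  have z0 : 0 < z by apply: lt_le_trans xz.
  have h : 0 < 1 + z ^+ 2 by have := sqr_ge0 z; lra.
  derE; first by rewrite gt_eqF.
  by field; rewrite !gt_eqF.
have z0 : 0 < z by apply: lt_trans xz.
by rewrite divr_gt0 ?exprn_gt0// subr_gt0 atan_gt.
Qed.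

Lemma under_b_lt x y : 0 < x -> x < y -> under_b x < under_b y.
Proof.
move=> x0 xy; rewrite /under_b ltrD// ltrN2; last exact: atan_div_lt.
by rewrite ltr_ln ?posrE ?osc_ratio_gt0 ?osc_ratio_lt// (lt_trans x0).
Qed.

Lemma under_b_gt x : 0 < x -> -1 < under_b x.
Proof.
move=> x0; rewrite /under_b.
have h : atan x / x < 1 by rewrite ltr_pdivrMr// mul1r atan_lt.
have : ln (osc_ratio x) <= 0 by rewrite ln_le0// /osc_ratio gerBl expR_ge0.
lra.
Qed.

Lemma under_c_lt x y : 0 < x -> x < y -> under_c y < under_c x.
Proof.
move=> x0 xy; rewrite -ltrN2.
apply: (@derive_gt0_lt _ (fun t => - under_c t)
  (fun t => - coth_atan_gap (pi / t) / t ^+ 2) _ _ xy) => z /andP[xz _].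
  have z0 : 0 < z by apply: lt_le_trans xz.
  have h : 0 < 1 + z ^+ 2 by have := sqr_ge0 z; lra.
  have := osc_ratio_gt0 z0; have := expR_sub1_gt0 (divr_gt0 (pi_gt0 R) z0).
  have := pi_gt0 R.
  rewrite /under_c /under_b /osc_ratio /coth_atan_gap; move: pi => p p0 e0 r0.
  derE; rewrite ?gt_eqF//.
  have -> : p / (p / z) = z by field; rewrite !gt_eqF.
  have eE : expR (- (p / z)) = (expR (p / z))^-1 by rewrite expRN.
  have := expR_gt0 (p / z); rewrite eE; move: (expR (p / z)) e0 => E e0 E0.
  field; rewrite !gt_eqF//.
have z0 : 0 < z by apply: lt_trans xz.
by rewrite divr_gt0 ?exprn_gt0// oppr_gt0 coth_atan_gap_lt0// divr_gt0// pi_gt0.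
Qed.

(** The value -1 is the limit at 0 of a decreasing function; passing first to [x / 2] makes the
    inequality strict. *)
Lemma under_c_lt_m1 x : 0 < x -> under_c x < -1.
Proof.
move=> x0; apply: (lt_le_trans (@under_c_lt (x / 2) x _ _)); [lra|lra|].
rewrite leNgt; apply/negP => h.
set e := under_c (x / 2) + 1; have e0 : 0 < e by rewrite /e; lra.
(* At this [y] the three terms of [under_c] are at most [y], [y^2 - 1] and 0, so their sum is at
   most [e - 1]. *)
pose y := Num.min (x / 4) (Num.min (e / 4) (1 / 2)).
have y0 : 0 < y by rewrite !lt_min !divr_gt0.
have yx : y <= x / 4 by rewrite ge_min lexx.
have ye : y <= e / 4 by rewrite !ge_min lexx orbT.
have y2 : y <= 1 / 2 by rewrite !ge_min lexx !orbT.
have : under_c (x / 2) < under_c y by apply: under_c_lt => //; lra.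
apply/negP; rewrite -leNgt.
have h1 : y / (1 + y ^+ 2) < atan y by apply: atan_gt.
have hy : 0 < 1 + y ^+ 2 by have := sqr_ge0 y; lra.
have h2 : 1 - y ^+ 2 <= atan y / y.
  rewrite ler_pdivlMr//; apply: le_trans (ltW h1).
  rewrite ler_pdivlMr// -subr_ge0.
  have -> : y - (1 - y ^+ 2) * y * (1 + y ^+ 2) = y ^+ 5 by ring.
  by rewrite exprn_ge0// ltW.
have h3 : 0 <= ln (1 + y ^+ 2) by rewrite ln_ge0// lerDl sqr_ge0.
have p1 : 2 <= pi :> R := pi_ge2 R.
have py : 0 < pi / y by rewrite divr_gt0// pi_gt0.
have E0 := expR_sub1_gt0 py.
have h4 : - ln (osc_ratio y) <= y.
  have -> : - ln (osc_ratio y) = ln (1 + (expR (pi / y) - 1)^-1).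
    rewrite -lnV ?posrE ?osc_ratio_gt0//; congr ln.
    rewrite /osc_ratio expRN; field.
    by rewrite !gt_eqF// ?expR_gt0.
  apply: le_trans (le_ln1Dx _) _; first by rewrite (lt_trans (ltrN10 R))// invr_gt0.
  rewrite -[leRHS]invrK lef_pV2 ?posrE ?invr_gt0//.
  have := @expR_ge1Dx R (pi / y).
  have : y^-1 <= pi / y by rewrite ler_peMl ?invr_ge0 ?ltW//; lra.
  lra.
have y3 : y ^+ 2 <= y by rewrite expr2 ler_piMr// ltW//; lra.
have : under_c y <= e - 1 by rewrite /under_c /under_b; lra.
rewrite /e; lra.
Qed.

Lemma exp_under_c d : 0 < d ->
  expR (under_c d) = (osc_ratio d * Num.sqrt (1 + d ^+ 2))^-1 * expR (- (atan d / d)).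
Proof.
move=> d0; have r0 := osc_ratio_gt0 d0.
have h : 0 < 1 + d ^+ 2 by have := sqr_ge0 d; lra.
have -> : under_c d = - ln (osc_ratio d) + (- (ln (1 + d ^+ 2) / 2) + - (atan d / d)).
  by rewrite /under_c /under_b; ring.
rewrite !expRD !expRN lnK ?posrE//.
have -> : ln (1 + d ^+ 2) / 2 = ln (Num.sqrt (1 + d ^+ 2)).
  by rewrite -{1}(sqr_sqrtr (ltW h)) lnXn ?sqrtr_gt0//; field.
by rewrite lnK ?posrE ?sqrtr_gt0// invfM mulrA.
Qed.

Lemma osc_ratio_le d : 0 < d -> osc_ratio d * d <= pi.
Proof.
move=> d0; rewrite -ler_pdivlMr//.
by have := @expR_ge1Dx R (- (pi / d)); rewrite /osc_ratio; lra.
Qed.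

(** This and [exp_under_c_upper] show that the limit at infinity is [1 / pi]. Here
    [osc_ratio d * d <= pi], [sqrt (1 + d^2) <= d (1 + 1 / d)] and [1 + 1 / d <= exp (1 / d)]. *)
Lemma exp_under_c_lower d : 0 < d -> expR (- ((1 + pi / 2) / d)) / pi <= expR (under_c d).
Proof.
move=> d0; rewrite exp_under_c// mulrC.
have h : 0 < 1 + d ^+ 2 by have := sqr_ge0 d; lra.
have s0 : 0 < Num.sqrt (1 + d ^+ 2) by rewrite sqrtr_gt0.
have r0 := osc_ratio_gt0 d0.
have -> : - ((1 + pi / 2) / d) = - (1 / d) + - (pi / 2 / d) by field; rewrite gt_eqF.
rewrite expRD mulrA; apply: ler_pM; rewrite ?mulr_ge0 ?expR_ge0 ?invr_ge0 ?pi_ge0//; last first.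
  rewrite ler_expR lerN2 ler_pM2r ?invr_gt0//.
  exact/ltW/atan_ltpi2.
rewrite expRN -invfM lef_pV2 ?posrE ?mulr_gt0 ?expR_gt0 ?pi_gt0//.
have sd : Num.sqrt (1 + d ^+ 2) <= 1 + d.
  rewrite -ler_sqr ?nnegrE ?sqr_sqrtr ?ltW//; nra.
have : osc_ratio d * Num.sqrt (1 + d ^+ 2) <= osc_ratio d * d * (1 + 1 / d).
  rewrite -mulrA ler_pM2l//; apply: le_trans sd _.
  by have -> : d * (1 + 1 / d) = 1 + d by field; rewrite gt_eqF.
move=> /le_trans; apply.
apply: ler_pM.
- by rewrite mulr_ge0// ltW.
- by rewrite addr_ge0// divr_ge0// ltW.
- exact: osc_ratio_le.
- exact: expR_ge1Dx.
Qed.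

(** It follows from [sqrt (1 + d^2) >= d] and [1 - exp (- x) >= x / (1 + x)] at [x = pi / d]. *)
Lemma exp_under_c_upper d : 0 < d -> expR (under_c d) <= pi^-1 + d^-1.
Proof.
move=> d0; rewrite exp_under_c//.
have h : 0 < 1 + d ^+ 2 by have := sqr_ge0 d; lra.
have s0 : 0 < Num.sqrt (1 + d ^+ 2) by rewrite sqrtr_gt0.
have r0 := osc_ratio_gt0 d0; have p0 := pi_gt0 R.
have e1 : expR (- (atan d / d)) <= 1.
  rewrite expR_le1 oppr_le0 divr_ge0 ?ltW//.
  by apply: lt_trans (atan_gt d0); rewrite divr_gt0.
apply: (@le_trans _ _ (osc_ratio d * Num.sqrt (1 + d ^+ 2))^-1).
  by rewrite ler_piMr// invr_ge0 mulr_ge0// ltW.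
have sd : d <= Num.sqrt (1 + d ^+ 2).
  by rewrite -ler_sqr ?nnegrE ?sqr_sqrtr ?lerDr// ltW.
have x0 : 0 < pi / d by rewrite divr_gt0.
have ro : (pi / d) / (1 + pi / d) <= osc_ratio d.
  rewrite /osc_ratio expRN.
  have := @expR_ge1Dx R (pi / d) => hx.
  have : (expR (pi / d))^-1 <= (1 + pi / d)^-1 by rewrite lef_pV2 ?posrE ?expR_gt0//; lra.
  have -> : pi / d / (1 + pi / d) = 1 - (1 + pi / d)^-1 by field; rewrite gt_eqF//; lra.
  lra.
have -> : pi^-1 + d^-1 = ((pi / d) / (1 + pi / d) * d)^-1.
  move: pi p0 {x0 ro} => p p0; field.
  by rewrite !gt_eqF// addr_gt0.
have ro0 : 0 < pi / d / (1 + pi / d) by rewrite divr_gt0// addr_gt0.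
rewrite lef_pV2 ?posrE; [|exact: mulr_gt0..].
by apply: ler_pM => //; exact: ltW.
Qed.

Lemma exp_under_c_gt d : 0 < d -> pi^-1 < expR (under_c d).
Proof.
move=> d0; rewrite ltNge; apply/negP => h.
have p0 := pi_gt0 R.
have h1 : expR (under_c (d + 1)) < expR (under_c d).
  by rewrite ltr_expR under_c_lt// ltrDl.
set e := expR (under_c d) - expR (under_c (d + 1)).
have e0 : 0 < e by rewrite subr_gt0.
pose C : R := (1 + pi / 2) / pi.
have C0 : 0 < C by rewrite divr_gt0// addr_gt0// divr_gt0.
(* Beyond [C / e] the lower bound exceeds [1 / pi - e], while monotonicity has already pushed the
   value below [1 / pi - e] at [d + 1]. *)
pose t := d + 2 + C / e.
have t0 : 0 < t by rewrite /t !addr_gt0// divr_gt0.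
have h2 : expR (under_c t) < expR (under_c (d + 1)).
  rewrite ltr_expR under_c_lt// ?addr_gt0//.
  by have : 0 < C / e by [rewrite divr_gt0]; rewrite /t; lra.
have h3 := exp_under_c_lower t0.
have : pi^-1 - C / t <= expR (- ((1 + pi / 2) / t)) / pi.
  have -> : pi^-1 - C / t = (1 + - ((1 + pi / 2) / t)) / pi.
    by rewrite /C; move: pi p0 => p p0; field; rewrite !gt_eqF.
  by rewrite ler_pM2r ?invr_gt0// expR_ge1Dx.
have : C / t < e.
  rewrite ltr_pdivrMr// mulrC -ltr_pdivrMr// /t; lra.
rewrite /e in e0 *; lra.
Qed.

Definition artanh x := (ln (1 + x) - ln (1 - x)) / 2.

(** Overdamped counterparts of [under_b] and [under_c]: [artanh] replaces [atan], [1 - d^2] replaces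
    [1 + d^2], and the oscillation factor disappears. *)
Definition over_b d := - (artanh d / d).

Definition over_c d := over_b d - ln (1 - d ^+ 2) / 2.

Lemma is_derive_artanh x : 0 <= x < 1 -> is_derive x 1 artanh (1 - x ^+ 2)^-1.
Proof.
move=> /andP[x0 x1]; rewrite /artanh; derE; try lra.
by field; rewrite !gt_eqF//; nra.
Qed.

Lemma artanh0 : artanh 0 = 0.
Proof. by rewrite /artanh addr0 subr0 subrr mul0r. Qed.

Lemma artanh_gt x : 0 < x < 1 -> x < artanh x.
Proof.
move=> /andP[x0 x1].
have : artanh 0 - 0 < artanh x - x.
  apply: (@derive_gt0_lt _ (fun t => artanh t - t)
    (fun t => (1 - t ^+ 2)^-1 - 1) _ _ x0) => z /andP[z0 zx].
    by derE; [apply: is_derive_artanh; rewrite z0 (le_lt_trans zx)|].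
  by rewrite subr_gt0 invf_gt1; nra.
by rewrite artanh0; lra.
Qed.

Lemma artanh_lt x : 0 < x < 1 -> artanh x < x / (1 - x ^+ 2).
Proof.
move=> /andP[x0 x1].
have : 0 / (1 - 0 ^+ 2) - artanh 0 < x / (1 - x ^+ 2) - artanh x.
  apply: (@derive_gt0_lt _ (fun t => t / (1 - t ^+ 2) - artanh t)
    (fun t => 2 * t ^+ 2 / (1 - t ^+ 2) ^+ 2) _ _ x0) => z /andP[z0 zx].
    have h : 0 < 1 - z ^+ 2 by nra.
    by derE; [rewrite gt_eqF|apply: is_derive_artanh; rewrite z0 (le_lt_trans zx)|
      field; rewrite gt_eqF].
  have h : 0 < 1 - z ^+ 2 by nra.
  by rewrite divr_gt0 ?exprn_gt0// mulr_gt0// exprn_gt0.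
by rewrite artanh0 mul0r; lra.
Qed.

Lemma over_b_lt x y : 0 < x -> x < y -> y < 1 -> over_b y < over_b x.
Proof.
move=> x0 xy y1; rewrite -ltrN2.
apply: (@derive_gt0_lt _ (fun t => - over_b t)
  (fun t => (t / (1 - t ^+ 2) - artanh t) / t ^+ 2) _ _ xy) => z /andP[xz zy].
  have h : 0 < 1 - z ^+ 2 by nra.
  rewrite /over_b; derE; [apply: is_derive_artanh; lra|by rewrite gt_eqF//; lra|].
  by field; rewrite !gt_eqF//; lra.
by rewrite divr_gt0 ?exprn_gt0 ?subr_gt0 ?artanh_lt//; lra.
Qed.

Lemma over_b_lt_m1 x : 0 < x < 1 -> over_b x < -1.
Proof.
move=> /[dup] h /andP[x0 x1].
by rewrite ltrN2 ltr_pdivlMr// mul1r artanh_gt.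
Qed.

Lemma over_c_lt x y : 0 < x -> x < y -> y < 1 -> over_c x < over_c y.
Proof.
move=> x0 xy y1.
apply: (@derive_gt0_lt _ over_c
  (fun t => (artanh t - t) / t ^+ 2) _ _ xy) => z /andP[xz zy].
  have h : 0 < 1 - z ^+ 2 by nra.
  rewrite /over_c /over_b; derE.
  - by apply: is_derive_artanh; lra.
  - by rewrite gt_eqF//; lra.
  - by [].
  - by field; rewrite !gt_eqF//; lra.
by rewrite divr_gt0 ?exprn_gt0 ?subr_gt0 ?artanh_gt//; lra.
Qed.

(** Multiplied by [x], the claim compares [artanh x] with [x (1 - ln (1 - x^2) / 2)]; the derivative
    of the difference reduces to [- ln (1 - x^2) / 2 > 0]. *)
Lemma over_c_gt_m1 x : 0 < x < 1 -> -1 < over_c x.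
Proof.
move=> /andP[x0 x1].
have : 0 * (1 - ln (1 - 0 ^+ 2) / 2) - artanh 0 < x * (1 - ln (1 - x ^+ 2) / 2) - artanh x.
  apply: (@derive_gt0_lt _ (fun t => t * (1 - ln (1 - t ^+ 2) / 2) - artanh t)
    (fun t => - ln (1 - t ^+ 2) / 2) _ _ x0) => z /andP[z0 zx].
    have h : 0 < 1 - z ^+ 2 by nra.
    derE => //; [by apply: is_derive_artanh; lra|].
    by field; rewrite !gt_eqF//; lra.
  have h : 0 < 1 - z ^+ 2 by nra.
  by rewrite divr_gt0// oppr_gt0 ln_lt0// h; nra.
rewrite artanh0 mul0r subr0 => h.
have : artanh x / x < 1 - ln (1 - x ^+ 2) / 2.
  by rewrite ltr_pdivrMr//; lra.
by rewrite /over_c /over_b; lra.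
Qed.

(** A form adapted to [x] near 1: the factor [1 - x] tames the singularity of [ln (1 - x)], leaving
    the limit [- ln 2]. *)
Lemma over_cE x : 0 < x < 1 ->
  over_c x = - ln (1 + x) - (1 - x) / (2 * x) * (ln (1 + x) - ln (1 - x)).
Proof.
move=> /andP[x0 x1]; rewrite /over_c /over_b /artanh.
have -> : 1 - x ^+ 2 = (1 + x) * (1 - x) by ring.
by rewrite lnM ?posrE; [field; rewrite gt_eqF|lra|lra].
Qed.

Lemma exp_over_c_le x : 0 < x < 1 -> expR (over_c x) <= (1 + x)^-1.
Proof.
move=> /[dup] h /andP[x0 x1]; rewrite over_cE//.
have -> : (1 + x)^-1 = expR (- ln (1 + x)) by rewrite expRN lnK// posrE; lra.
rewrite ler_expR gerBl mulr_ge0 ?divr_ge0//; try lra.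
by rewrite subr_ge0 ler_ln ?posrE//; lra.
Qed.

Lemma exp_over_c_lt x : 0 < x < 1 -> expR (over_c x) < 2^-1.
Proof.
move=> /[dup] h /andP[x0 x1]; rewrite ltNge; apply/negP => hx.
have : expR (over_c x) < expR (over_c ((1 + x) / 2)).
  by rewrite ltr_expR; apply: over_c_lt; lra.
set e := expR (over_c ((1 + x) / 2)) => he.
have e0 : 0 < e - 2^-1 by lra.
(* The first bound puts [t] past [(1 + x) / 2]; the second gives
   [1 / (1 + t) <= 1 / 2 + (1 - t) / 2 < e]. *)
pose t := Num.max ((3 + x) / 4) (1 - (e - 2^-1)).
have t1 : t < 1 by rewrite gt_max; apply/andP; split; lra.
have tx : (3 + x) / 4 <= t by rewrite le_max lexx.
have te : 1 - (e - 2^-1) <= t by rewrite le_max lexx orbT.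
have : e < expR (over_c t) by rewrite ltr_expR; apply: over_c_lt; lra.
have : expR (over_c t) <= (1 + t)^-1 by apply: exp_over_c_le; lra.
have : (1 + t)^-1 <= 2^-1 + (1 - t) / 2.
  rewrite invf_ple ?posrE; try lra.
  rewrite -[leLHS]mul1r ler_pdivrMr; [nra|lra].
lra.
Qed.

Lemma exp_over_c_lower e : 0 < e -> exists2 x, 0 < x < 1 & 2^-1 - e < expR (over_c x).
Proof.
move=> e0.
(* At [1 - h] the exponent deviates from [- ln (2 - h)] by a multiple of [h |ln h|]; the bound
   [|ln h| <= 2 / sqrt h] keeps this below [4 sqrt h <= e]. *)
pose h : R := Num.min (1 / 2) (e ^+ 2 / 16).
have h0 : 0 < h by rewrite lt_min !divr_gt0 ?exprn_gt0.
have h1 : h <= 1 / 2 by rewrite ge_min lexx.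
have he : h <= e ^+ 2 / 16 by rewrite ge_min lexx orbT.
exists (1 - h); first lra.
have hi : 0 < 1 - h < 1 by lra.
rewrite over_cE// expRD expRN lnK ?posrE; last lra.
have hs : 0 < Num.sqrt h by rewrite sqrtr_gt0.
have hs2 : Num.sqrt h ^+ 2 = h by rewrite sqr_sqrtr ?ltW.
have hse : Num.sqrt h <= e / 4.
  by rewrite leNgt; apply/negP => hh; move: hs2; nra.
have l1 : ln (1 + (1 - h)) <= 1 - h by apply: le_ln1Dx; lra.
have l2 : - ln h <= 2 * (Num.sqrt h)^-1.
  have -> : - ln h = 2 * ln (Num.sqrt h)^-1.
    by rewrite lnV ?posrE// -{1}hs2 lnXn//; ring.
  by rewrite ler_pM2l// ltW// ln_sublinear// invr_gt0.
set w := (X in expR (- X)).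
have hw : w <= 4 * Num.sqrt h.
  have hV : 1 <= (Num.sqrt h)^-1 by rewrite invf_ge1//; move: hs2; nra.
  have -> : 4 * Num.sqrt h = 4 * h * (Num.sqrt h)^-1 by rewrite -{2}hs2; field; rewrite gt_eqF.
  rewrite /w.
  have -> : 1 - (1 - h) = h by ring.
  have a1 : h / (2 * (1 - h)) <= h.
    rewrite ler_pdivrMr; [nra|lra].
  have a2 : ln (1 + (1 - h)) - ln h <= 3 * (Num.sqrt h)^-1 by lra.
  have a3 : 0 <= ln (1 + (1 - h)) - ln h by rewrite subr_ge0 ler_ln ?posrE//; lra.
  have a4 : 0 <= h / (2 * (1 - h)) by rewrite divr_ge0; lra.
  have := ler_pM a4 a3 a1 a2; nra.
have := @expR_ge1Dx R (- w) => hx.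
have hy : 2^-1 <= (1 + (1 - h))^-1 by rewrite lef_pV2 ?posrE; lra.
have hz : (1 + (1 - h))^-1 <= 1 by rewrite invf_le1; lra.
have he0 : 0 < expR (- w) := expR_gt0 _.
suff : 2^-1 - e < 2^-1 * expR (- w) by nra.
lra.
Qed.

End Profiles.

(** * The variation of the fundamental solution bounds the velocity *)

Section Integrals.
Context {R : realType}.
Local Notation mu := (@lebesgue_measure R).
Implicit Types (f g F : R -> R) (s t x : R).

Lemma continuous_in_itv_within f s t :
  (forall x, s <= x <= t -> {for x, continuous f}) -> {within `[s, t], continuous f}.
Proof.
by move=> cf; apply: continuous_in_subspaceT => x; rewrite inE /= in_itv; exact: cf.
Qed.

Lemma continuous_integrable f s t :
  (forall x, s <= x <= t -> {for x, continuous f}) ->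
  mu.-integrable `[s, t] (EFin \o f).
Proof.
move=> cf; apply: continuous_compact_integrable; first exact: segment_compact.
exact: continuous_in_itv_within.
Qed.

Lemma Rintegral_derive F f s t : s <= t ->
  (forall x, s <= x <= t -> is_derive x 1 F (f x)) ->
  (forall x, s <= x <= t -> {for x, continuous f}) ->
  \int[mu]_(x in `[s, t]) f x = F t - F s.
Proof.
rewrite le_eqVlt => /predU1P[->|st] dF cf.
  by rewrite set_itv1 Rintegral_set1 subrr.
rewrite /Rintegral (@continuous_FTC2 _ f F s t st)//.
- exact: continuous_in_itv_within.
- have cF x : s <= x <= t -> {for x, continuous F}.
    by move=> xi; apply: is_derive_continuous (dF _ xi).
  split.
  + by move=> x; rewrite in_itv => /andP[sx xt]; have := dF x; rewrite !ltW// => /(_ isT)[].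
  + by apply: cvg_at_right_filter; apply: cF; rewrite lexx ltW.
  + by apply: cvg_at_left_filter; apply: cF; rewrite lexx ltW.
- move=> x; rewrite in_itv => /andP[sx xt].
  by rewrite derive1E; have := dF x; rewrite !ltW// => /(_ isT)[_ ->].
Qed.

Lemma ae_norm_Rintegral_le f (M : R) s t : s <= t -> 0 <= M ->
  mu.-integrable `[s, t] (EFin \o f) ->
  {ae mu, forall x, x \in `[s, t] -> `|f x| <= M} ->
  `|\int[mu]_(x in `[s, t]) f x| <= M * (t - s).
Proof.
move=> st M0 fi fM; have mf := measurable_int _ fi.
rewrite -lee_fin EFin_normr_Rintegral//.
apply: le_trans (le_abse_integral _ _ mf) _ => //.
apply: (@le_trans _ _ (\int[mu]_(x in `[s, t]) (cst M%:E) x)%E).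
  apply: ae_ge0_le_integral => //=.
  by apply/measurable_EFinP; apply: measurableT_comp => //; exact/measurable_EFinP.
rewrite integral_cst//= lebesgue_measure_itv/= lte_fin.
case: ltP => h; first by rewrite -EFinB -EFinM.
by rewrite mule0 lee_fin mulr_ge0// subr_ge0.
Qed.

Lemma primitive_continuous f g x : 0 < x -> is_primitive f g -> {for x, continuous f}.
Proof.
move=> x0 fg; pose s := x / 2; pose t := x * 2.
have [gi _] : mu.-integrable `[s, t] (EFin \o g) /\ f t - f s = \int[mu]_(r in `[s, t]) g r.
  by apply: fg; rewrite /s /t; lra.
have st : s <= t by rewrite /s /t; lra.
have := parameterized_integral_continuous st gi.
have sx : s < x < t by rewrite /s /t; lra.
have st' : s < t by rewrite /s /t; lra.
move=> /(continuous_within_itvP _ st')[+ _ _] => /(_ x).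
rewrite in_itv /= sx => /(_ isT) cx.
rewrite /prop_for /continuous_at in cx *.
have fE y : s <= y -> f y = f s + parameterized_integral mu s y g.
  move=> sy; have [_] := fg s y (divr_gt0 x0 (ltr0Sn _ 1)) sy.
  by rewrite /parameterized_integral => <-; ring.
have sx' : s < x by case/andP: sx.
have cS : f s + parameterized_integral mu s y g @[y --> x] -->
          f s + parameterized_integral mu s x g.
  by apply: cvgD; [exact: cvg_cst|exact: cx].
rewrite (fE x) ?ltW//; apply: cvg_trans cS.
apply: near_eq_cvg; near=> y; rewrite (fE y)//.
by near: y; exact: lt_le_nbhsr.
Unshelve. all: by end_near. Qed.

Lemma diff_quotient_cvg F x l : is_derive x 1 F l ->
  (F (x + h) - F x) / h @[h --> 0^'+] --> l.
Proof.
move=> [dF <-].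
have : h^-1 *: (F (h *: 1 + x) - F x) @[h --> 0^'] --> 'D_1 F x by exact: dF.
move=> /cvg_dnbhs_at_right.
rewrite [X in X @ _ --> _](_ : _ = fun h => (F (x + h) - F x) / h)//.
by apply/funext => h; rewrite /GRing.scale /= mulr1 mulrC [h + x]addrC.
Qed.

End Integrals.

(** * Increments of the Duhamel expression *)

Section Duhamel.
Context {R : realType}.
Local Notation mu := (@lebesgue_measure R).
Implicit Types (f g u v F : R -> R) (s t r h x M : R).
Variables (b c : R) (G G1 : R -> R).

Definition fundamental_solution :=
  [/\ G 0 = 0, G1 0 = 1, (forall t : R, is_derive t 1 G (G1 t)) &
      (forall t : R, is_derive t 1 G1 (- (c * G1 t) - b * G t))].

Hypothesis GP : fundamental_solution.

(* Used with [v1 = v']; the value at [s = t] is then [v' t]. *)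
Definition duhamel t v v1 (s : R) : R := G1 (t - s) * v1 s - b * (G (t - s) * v s).

(** Here [sg] is the constant sign of [G'] on the interval. Adding or subtracting [duhamel] to
    [- M sg G (t - s)] gives two nondecreasing functions of [s], selected below by [e = 1] and
    [e = -1]. *)
Lemma duhamel_smooth (v v1 v2 : R -> R) (M sg t s1 s2 : R) : s1 <= s2 ->
  (forall s, s1 <= s <= s2 -> [/\ is_derive s 1 v (v1 s), is_derive s 1 v1 (v2 s) &
     `|v2 s + c * v1 s + b * v s| <= M]) ->
  (forall s, s1 <= s <= s2 -> 0 <= sg * G1 (t - s)) -> sg ^+ 2 = 1 ->
  `|duhamel t v v1 s2 - duhamel t v v1 s1| <= M * (sg * (G (t - s1) - G (t - s2))).
Proof.
case: GP => _ _ dG dG1 s12 vP Gsg sg2.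
have dGs (s : R) : is_derive s 1 (fun r => G (t - r)) (- G1 (t - s)).
  notypeclasses refine (is_derive_eq (is_derive_compf (dG _) _) _); [der|ring].
have dG1s (s : R) : is_derive s 1 (fun r => G1 (t - r)) (c * G1 (t - s) + b * G (t - s)).
  notypeclasses refine (is_derive_eq (is_derive_compf (dG1 _) _) _); [der|ring].
have key e : e ^+ 2 = 1 ->
    0 <= M * (sg * (G (t - s1) - G (t - s2))) - e * (duhamel t v v1 s2 - duhamel t v v1 s1).
  move=> e2.
  suff : - (M * sg * G (t - s1)) - e * duhamel t v v1 s1 <=
         - (M * sg * G (t - s2)) - e * duhamel t v v1 s2 by lra.
  apply: (@derive_ge0_le _ (fun s => - (M * sg * G (t - s)) - e * duhamel t v v1 s)
    (fun s => M * (sg * G1 (t - s)) - e * G1 (t - s) * (v2 s + c * v1 s + b * v s)) _ _ s12).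
    move=> s si; have [dv dv1 _] := vP s si.
    rewrite /duhamel; derE; [exact: dGs|exact: dG1s|exact: dv1|exact: dGs|exact: dv|].
    by ring.
  move=> s /andP[a1 a2]; have si : s1 <= s <= s2 by rewrite !ltW.
  have [_ _ hM] := vP s si; have hG := Gsg s si.
  rewrite subr_ge0; apply: le_trans (ler_norm _) _.
  have n1 : `|e| = 1 by apply/eqP; rewrite -sqrp_eq1// -normrX e2 normr1.
  have n2 : `|sg| = 1 by apply/eqP; rewrite -sqrp_eq1// -normrX sg2 normr1.
  rewrite !normrM n1 mul1r -[`|G1 _|]mul1r -n2 -normrM (ger0_norm hG) mulrC.
  by rewrite ler_wpM2r.
rewrite ler_norml; have := key 1; have := key (-1).
rewrite sqrrN expr1n => /(_ erefl) k1 /(_ erefl) k2.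
by lra.
Qed.

Lemma duhamel_solution (f u : R -> R) (M sg t s1 s2 : R) : 0 < s1 -> s1 <= s2 -> 0 <= M ->
  is_solution b c f u ->
  {ae mu, forall r, s1 <= r -> `|f r| <= M} ->
  (forall s, s1 <= s <= s2 -> 0 <= sg * G1 (t - s)) -> sg ^+ 2 = 1 ->
  `|duhamel t u (derive1 u) s2 - duhamel t u (derive1 u) s1| <=
  M * (sg * (G (t - s1) - G (t - s2))).
Proof.
move=> s10 s12 M0 [du [w [wP eqn]]] fM Gsg sg2.
have du' (s : R) : 0 < s -> is_derive s 1 u (derive1 u s).
  by move=> s0; rewrite derive1E; apply: derivableP; exact: du.
have cu s : 0 < s -> {for s, continuous u}.
  by move=> /du'; exact: is_derive_continuous.
have cu' s : 0 < s -> {for s, continuous (derive1 u)}.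
  by move=> s0; exact: primitive_continuous wP.
(* The base point lies strictly between 0 and [s1], so that [U] is differentiable at [s1] too. *)
pose a := s1 / 2.
have a0 : 0 < a by rewrite divr_gt0.
have as1 : a < s1 by rewrite /a; lra.
pose U x := \int[mu]_(r in `[a, x]) u r.
have dU s : a < s -> is_derive s 1 U (u s).
  move=> sa.
  have [] : derivable U s 1 /\ derive1 U s = u s.
    apply: (@continuous_FTC1_closed _ u a s (s + 1)) => //; first by rewrite ltrDl.
    - apply: continuous_integrable => x /andP[ax _]; apply: cu.
      exact: lt_le_trans ax.
    - by apply: cu; apply: lt_trans sa.
  by move=> dd <-; rewrite derive1E; exact: derivableP.
pose v h s := (U (s + h) - U s) / h.
pose v1 h s := (u (s + h) - u s) / h.
have step (h : R) : 0 < h ->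
    `|duhamel t (v h) (v1 h) s2 - duhamel t (v h) (v1 h) s1| <=
    M * (sg * (G (t - s1) - G (t - s2))).
  move=> h0.
  apply: (@duhamel_smooth _ _ (fun s => (derive1 u (s + h) - derive1 u s) / h)) => //.
  move=> s /andP[ss1 ss2].
  have sa : a < s by apply: lt_le_trans ss1.
  have s0 : 0 < s by apply: lt_trans sa.
  have sh : s <= s + h by rewrite lerDl ltW.
  have sha : a < s + h by apply: lt_le_trans sh.
  have pos x : s <= x <= s + h -> 0 < x by move=> /andP[sx _]; apply: lt_le_trans sx.
  split.
  - rewrite /v /v1; derE.
    + by notypeclasses refine (is_derive_compf (dU _ _) _); [exact: sha|der].
    + exact: dU.
    + by ring.
  - rewrite /v1; derE.
    + by notypeclasses refine (is_derive_compf (du' _ _) _); [exact: lt_le_trans sh|der].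
    + exact: du'.
    + by ring.
  have [wi wE] := wP s (s + h) s0 sh.
  have u'i : mu.-integrable `[s, s + h] (EFin \o derive1 u).
    by apply: continuous_integrable => x /pos; exact: cu'.
  have ui : mu.-integrable `[s, s + h] (EFin \o u).
    by apply: continuous_integrable => x /pos; exact: cu.
  have u'E : \int[mu]_(r in `[s, s + h]) derive1 u r = u (s + h) - u s.
    by apply: Rintegral_derive => // x /pos; [exact: du'|exact: cu'].
  have uE : \int[mu]_(r in `[s, s + h]) u r = U (s + h) - U s.
    apply: Rintegral_derive => // x; last by move=> /pos; exact: cu.
    by move=> /andP[sx _]; apply: dU; apply: lt_le_trans sx.
  have cu'i : mu.-integrable `[s, s + h] (EFin \o (fun r => c * derive1 u r)).
    exact: (integrableZl _ c u'i).
  have bui : mu.-integrable `[s, s + h] (EFin \o (fun r => b * u r)).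
    exact: (integrableZl _ b ui).
  have wcui : mu.-integrable `[s, s + h] (EFin \o (fun r => w r + c * derive1 u r)).
    exact: (integrableD _ wi cu'i).
  have alli : mu.-integrable `[s, s + h] (EFin \o (fun r => w r + c * derive1 u r + b * u r)).
    exact: (integrableD _ wcui bui).
  (* Averaging turns the almost everywhere bound on the equation into a bound at every [s] for the
     averaged function. *)
  have : `|\int[mu]_(r in `[s, s + h]) (w r + c * derive1 u r + b * u r)| <= M * (s + h - s).
    apply: ae_norm_Rintegral_le => //.
    move: eqn fM; apply: filterS2; first exact: (ae_filter_ringOfSetsType mu).
    move=> r h1 h2; rewrite in_itv => ri.
    rewrite h1; last exact: pos ri.
    by apply: h2; apply: le_trans ss1 _; case/andP: ri.
  rewrite RintegralD// RintegralD// !RintegralZl// -wE u'E uE.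
  have -> : s + h - s = h by ring.
  rewrite -ler_pdivrMr// -[X in _ / X](gtr0_norm h0) -normf_div => hM.
  apply: le_trans hM; rewrite le_eqVlt; apply/orP; left; apply/eqP.
  by congr `|_|; rewrite /v /v1; ring.
have cv s : s1 <= s -> duhamel t (v h) (v1 h) s @[h --> 0^'+] --> duhamel t u (derive1 u) s.
  move=> ss1; have sa : a < s by apply: lt_le_trans ss1.
  rewrite /duhamel; apply: cvgB.
    by apply: cvgMr; apply: diff_quotient_cvg; apply: du'; apply: lt_trans sa.
  by apply: cvgMr; apply: cvgMr; apply: diff_quotient_cvg; apply: dU.
have : `|duhamel t (v h) (v1 h) s2 - duhamel t (v h) (v1 h) s1| @[h --> 0^'+] -->
       `|duhamel t u (derive1 u) s2 - duhamel t u (derive1 u) s1|.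
  by apply: cvg_norm; apply: cvgB; apply: cv.
move=> /ler_cvg_to; apply; first exact: cvg_cst.
by near=> h; apply: step.
Unshelve. all: by end_near. Qed.

End Duhamel.

(** * Essential and pointwise upper limits *)

Section TailNorm.
Context {R : realType}.
Local Notation mu := (@lebesgue_measure R).
Implicit Types (f v : R -> R) (M T : R).

Lemma tail_Linfty_normE f T : tail_Linfty_norm f T =
  ess_sup mu (abse \o (EFin \o (f \_ `]T, +oo[))).
Proof.
(* The definition of the norm branches on whether the whole space has positive measure; the unit
   interval settles it. *)
rewrite /tail_Linfty_norm unlock ifT//.
have : (mu `[0%R, 1%R] <= mu setT)%E by apply: le_measure; rewrite ?inE.
by apply: lt_le_trans; rewrite lebesgue_measure_itv/= lte_fin ltr01 lte_fin subr0.
Qed.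

Lemma tail_Linfty_norm_ge0 f T : (0 <= tail_Linfty_norm f T)%E.
Proof. exact: Lnorm_ge0. Qed.

Lemma tail_Linfty_norm_nonincreasing f : nonincreasing_fun (tail_Linfty_norm f).
Proof.
move=> T S TS; rewrite !tail_Linfty_normE; apply: le_ess_sup.
apply: aeW => r /=; rewrite lee_fin !patchE.
case: ifPn => [|_]; last by rewrite normr0.
rewrite inE /= in_itv /= andbT => Sr.
by rewrite mem_set//= in_itv /= andbT (le_lt_trans TS).
Qed.

Lemma ess_limsup_absE f :
  ess_limsup_abs f = ereal_inf (range (tail_Linfty_norm f)).
Proof.
apply: cvg_lim => //; exact: nonincreasing_cvge (@tail_Linfty_norm_nonincreasing f).
Qed.

Lemma tail_Linfty_norm_ae f T M : (tail_Linfty_norm f T <= M%:E)%E ->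
  {ae mu, forall r, T < r -> `|f r| <= M}.
Proof.
rewrite tail_Linfty_normE => /ess_supP; apply: filterS.
move=> r /=; rewrite lee_fin patchE => + Tr.
by rewrite mem_set//= in_itv /= andbT.
Qed.

Lemma ess_limsup_abs_le f M : 0 <= M -> (forall r, `|f r| <= M) ->
  (ess_limsup_abs f <= M%:E)%E.
Proof.
move=> M0 fM; rewrite ess_limsup_absE.
apply: le_trans (ereal_inf_lbound _) _; first by exists 0.
rewrite tail_Linfty_normE; apply/ess_supP; apply: aeW => r /=.
by rewrite lee_fin patchE; case: ifPn => // _; rewrite normr0.
Qed.

Lemma limsup_abs_le v M : (forall e : R, 0 < e -> exists A, forall t, A < t -> `|v t| <= M + e) ->
  (limsup_abs v <= M%:E)%E.
Proof.
move=> vM; apply/lee_addgt0Pr => e /vM[A hA].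
rewrite /limsup_abs limf_esupE; apply: ge_ereal_inf.
exists (ereal_sup ((fun t : R => `|v t|%:E) @` [set t | A < t])).
  exists [set t | A < t] => //; exists A; split; first exact: num_real.
  by move=> x.
apply: ge_ereal_sup => _ [t /= At <-].
by rewrite -EFinD lee_fin hA.
Qed.

Lemma limsup_abs_ge v M : (forall A, exists2 t, A < t & M <= `|v t|) ->
  (M%:E <= limsup_abs v)%E.
Proof.
move=> vM; rewrite /limsup_abs limf_esupE; apply: le_ereal_inf_tmp.
move=> _ [V [A [_ AV]] <-]; have [t At Mt] := vM A.
apply: (@le_trans _ _ (`|v t|%:E)%E); first by rewrite lee_fin.
by apply: ereal_sup_ubound; exists t => //; exact: AV.
Qed.

End TailNorm.

(** * From the variation of [G] to a velocity bound *)

Section UpperBound.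
Context {R : realType}.
Local Notation mu := (@lebesgue_measure R).
Implicit Types (f u phi F : R -> R) (t r e x y z M A : R).
Variables (b c : R) (G G1 : R -> R) (K : R).

Definition vanishing F := forall e, 0 < e -> exists A, forall t, A <= t -> `|F t| <= e.

(* [K] bounds the total variation of [G] on [0, +oo), stated through functions [phi]
   whose increments are controlled by those of [G] where [G] is monotone. *)
Definition variation_bound := forall phi M r, 0 <= r -> 0 <= M ->
  (forall sg x y, 0 <= x -> x <= y -> y <= r -> sg ^+ 2 = 1 ->
     (forall z, x <= z <= y -> 0 <= sg * G1 z) ->
     `|phi y - phi x| <= M * (sg * (G y - G x))) ->
  `|phi r - phi 0| <= M * K.

Hypothesis GP : fundamental_solution b c G G1.
Hypothesis G_vanishing : vanishing G.
Hypothesis G1_vanishing : vanishing G1.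
Hypothesis GK : variation_bound.
Hypothesis K_gt0 : 0 < K.

(** Reversing time from [t] turns increments of [duhamel] on [[T, t]] into increments controlled by
    [G] on [[0, t - T]]; the boundary term at [T] remains. *)
Lemma derivative_bound f u T t M : 0 < T -> T <= t -> 0 <= M ->
  is_solution b c f u -> {ae mu, forall r, T <= r -> `|f r| <= M} ->
  `|derive1 u t| <= `|duhamel b G G1 t u (derive1 u) T| + M * K.
Proof.
move=> T0 Tt M0 uP fM.
have -> : derive1 u t = duhamel b G G1 t u (derive1 u) t.
  by case: GP => G0 G10 _ _; rewrite /duhamel subrr G0 G10; ring.
pose phi x := duhamel b G G1 t u (derive1 u) (t - x).
have : `|phi (t - T) - phi 0| <= M * K.
  apply: GK; rewrite ?subr_ge0// => sg x y x0 xy yT sg2 Gsg.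
  have ty : T <= t - y by lra.
  have h := @duhamel_solution _ b c G G1 GP f u M sg t (t - y) (t - x).
  rewrite distrC; apply: le_trans (h _ _ M0 uP _ _ sg2) _.
  - exact: lt_le_trans ty.
  - by rewrite lerD2l lerN2.
  - move: fM; apply: filterS; first exact: (ae_filter_ringOfSetsType mu).
    by move=> r hr tr; apply: hr; apply: le_trans tr.
  - by move=> s /andP[s1 s2]; apply: Gsg; lra.
  - have -> : t - (t - y) = y by ring.
    by have -> : t - (t - x) = x by ring.
rewrite /phi subr0 subKr => h.
rewrite -[X in `|X|](subrK (duhamel b G G1 t u (derive1 u) T)) addrC.
by apply: le_trans (ler_normD _ _) _; rewrite lerD2l distrC.
Qed.

Lemma velocity_bound_of_variation : velocity_bound b c K.
Proof.
move=> f u fA uP; rewrite -lee_pdivrMl// ess_limsup_absE.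
apply: le_ereal_inf_tmp => _ [T _ <-].
have [T' T'0 TT'] : exists2 T', 0 < T' & T <= T'.
  exists (Num.max 1 T); first by rewrite lt_max ltr01.
  by rewrite le_max lexx orbT.
apply: le_trans (tail_Linfty_norm_nonincreasing f TT').
rewrite lee_pdivrMl//.
have := tail_Linfty_norm_ge0 f T'.
case E : (tail_Linfty_norm f T') => [M| |//]; last first.
  by move=> _; rewrite gt0_muley ?lte_fin// leey.
rewrite lee_fin => M0; rewrite -EFinM; apply: limsup_abs_le => e e0.
have fM : {ae mu, forall r, T' + 1 <= r -> `|f r| <= M}.
  have : (tail_Linfty_norm f T' <= M%:E)%E by rewrite E.
  move=> /tail_Linfty_norm_ae; apply: filterS; first exact: (ae_filter_ringOfSetsType mu).
  by move=> r hr Tr; apply: hr; lra.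
set S := T' + 1 in fM *; have S0 : 0 < S by rewrite addr_gt0.
(* [D] dominates the data at [S], with 1 added to be positive; once [G] and [G1] are below [e / D],
   the boundary term is below [e]. *)
pose D := `|derive1 u S| + `|b| * `|u S| + 1.
have D0 : 0 < D by rewrite ltr_wpDl// addr_ge0// mulr_ge0.
have [A1 h1] := G_vanishing (divr_gt0 e0 D0).
have [A2 h2] := G1_vanishing (divr_gt0 e0 D0).
exists (Num.max S (Num.max (S + A1) (S + A2))) => t.
rewrite !gt_max => /andP[St /andP[t1 t2]].
apply: le_trans (derivative_bound S0 (ltW St) M0 uP fM) _.
rewrite mulrC addrC lerD2l /duhamel.
apply: le_trans (ler_normB _ _) _; rewrite !normrM.
have k1 := h1 (t - S); have k2 := h2 (t - S).
apply: (@le_trans _ _ (e / D * (`|derive1 u S| + `|b| * `|u S|))).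
  rewrite mulrDr; apply: lerD.
    by apply: ler_wpM2r => //; apply: k2; lra.
  rewrite mulrCA; apply: ler_wpM2r; [by rewrite mulr_ge0|apply: k1; lra].
rewrite mulrAC ler_pdivrMr// ler_pM2l//; rewrite /D; lra.
Qed.

End UpperBound.

(** * Responses to square waves *)

Section Primitives.
Context {R : realType}.
Local Notation mu := (@lebesgue_measure R).
Implicit Types (F f v w : R -> R) (a s t k : R).

Definition step F a t := if a <= t then F (t - a) else 0.

Lemma step_ge F a t : a <= t -> step F a t = F (t - a).
Proof. by rewrite /step => ->. Qed.

Lemma step_lt F a t : t < a -> step F a t = 0.
Proof. by rewrite /step leNgt => ->. Qed.

Lemma step_patch F a : step F a = (fun t => F (t - a)) \_ `[a, +oo[.
Proof.
by apply/funext => t; rewrite patchE /step mem_setE in_itv /= andbT.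
Qed.

Lemma is_derive_shiftf F f a t : is_derive (t - a) 1 F (f (t - a)) ->
  is_derive t 1 (fun r => F (r - a)) (f (t - a)).
Proof.
move=> dF.
notypeclasses refine (is_derive_eq (@is_derive_compf _ F (fun r => r - a) t _ _ dF _) _); [der|ring].
Qed.

(** At the junction [t = a] the right derivative is [f 0 = 0], which matches the zero function on
    the left. *)
Lemma is_derive_step F f a t : F 0 = 0 -> f 0 = 0 ->
  (forall r : R, is_derive r 1 F (f r)) -> is_derive t 1 (step F a) (step f a t).
Proof.
move=> F0 f0 dF; case: (ltgtP a t) => [at_|ta|->].
- rewrite (step_ge _ (ltW at_)).
  apply: near_eq_is_derive (is_derive_shiftf (dF _)).
  near=> r; rewrite step_ge//.
  by near: r; exact: lt_le_nbhsr.
- rewrite (step_lt _ ta).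
  apply: near_eq_is_derive (is_derive_cst 0 _ _).
  near=> r; rewrite step_lt//.
  by near: r; exact: lt_nbhsl.
- rewrite step_ge// subrr f0.
  have [dF0 eF0] := dF 0; rewrite f0 in eF0.
  have : h^-1 *: (F (h *: 1 + 0) - F 0) @[h --> 0^'] --> 'D_1 F 0 by exact: dF0.
  rewrite eF0 => /cvgrPdist_le cF.
  have cS : h^-1 *: (step F t (h *: 1 + t) - step F t t) @[h --> 0^'] --> (0 : R).
    apply/cvgrPdist_le => e e0; move: (cF e e0); apply: filterS => h.
    rewrite (step_ge F (lexx t)) subrr F0 !subr0 addr0 /step.
    case: ifPn => _; first by rewrite addrK.
    by rewrite scaler0 subr0 normr0 => _; exact: ltW.
  by apply: DeriveDef; [exact: cvgP cS|exact: cvg_lim cS].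
Unshelve. all: by end_near. Qed.

Lemma step_integrable F a s t : (forall r, {for r, continuous F}) ->
  mu.-integrable `[s, t] (EFin \o step F a).
Proof.
move=> cF; rewrite step_patch -restrict_EFin; apply/integrable_restrict => //=.
have H : mu.-integrable `[s, t] (EFin \o (fun r => F (r - a))).
  apply: continuous_integrable => x _; apply: continuous_comp; last exact: cF.
  by apply: continuousB; [exact: cvg_id|exact: cvg_cst].
by apply: integrableS H => //; exact: measurableI.
Qed.

(** Here [step f a] may jump at [a], as happens for [f = G1] with [G1 0 = 1]; hence an integral
    statement rather than a pointwise derivative. *)
Lemma is_primitive_step F f a : F 0 = 0 -> (forall r : R, is_derive r 1 F (f r)) ->
  (forall r, {for r, continuous f}) -> is_primitive (step F a) (step f a).
Proof.
move=> F0 dF cf s t s0 st; split; first exact: step_integrable.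
rewrite [step f a in RHS]step_patch -Rintegral_mkcondr.
have [ta|at_] := ltP t a.
  rewrite !step_lt ?(le_lt_trans st)// subrr.
  rewrite (_ : _ `&` _ = set0) ?Rintegral_set0//.
  apply/seteqP; split => // x [] /=; rewrite !in_itv /= andbT.
  by move=> /andP[_ xt] /(lt_le_trans (le_lt_trans xt ta)); rewrite ltxx.
rewrite (_ : _ `&` _ = `[Num.max s a, t]%classic); last first.
  apply/seteqP; split => x /=; rewrite !in_itv /= ?andbT ge_max.
    by move=> [/andP[-> ->] ->].
  by move=> /andP[/andP[-> ->] ->].
have -> : \int[mu]_(x in `[Num.max s a, t]) f (x - a) = F (t - a) - F (Num.max s a - a).
  apply: (@Rintegral_derive _ (fun x => F (x - a)) (fun x => f (x - a))).
  - by rewrite ge_max st.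
  - by move=> x _; exact: is_derive_shiftf.
  - move=> x _; apply: continuous_comp; last exact: cf.
    by apply: continuousB; [exact: cvg_id|exact: cvg_cst].
rewrite (step_ge _ at_); congr (_ - _).
case: (leP s a) => sa; last by rewrite step_ge// ltW.
rewrite subrr F0; move: sa; rewrite le_eqVlt => /predU1P[->|sa].
  by rewrite step_ge// subrr F0.
by rewrite step_lt.
Qed.

Lemma is_primitive_lin v1 w1 v2 w2 k : is_primitive v1 w1 -> is_primitive v2 w2 ->
  is_primitive (fun t => v1 t + k * v2 t) (fun t => w1 t + k * w2 t).
Proof.
move=> h1 h2 s t s0 st; have [i1 e1] := h1 s t s0 st; have [i2 e2] := h2 s t s0 st.
have i3 : mu.-integrable `[s, t] (EFin \o (fun r => k * w2 r)).
  exact: (integrableZl _ k i2).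
split; first exact: (integrableD _ i1 i3).
by rewrite RintegralD// RintegralZl// -e1 -e2; ring.
Qed.

End Primitives.

(** * Square waves and their responses *)

Section SquareWave.
Context {R : realType}.
Local Notation mu := (@lebesgue_measure R).
Implicit Types (F f v w : R -> R) (s t k : R).
Variables (b c : R) (G G1 : R -> R) (a : nat -> R) (d : R).
Hypothesis b0 : b != 0.
Hypothesis GP : fundamental_solution b c G G1.
Hypothesis a_le : forall n m, (n <= m)%N -> a n <= a m.
Hypothesis d_gt0 : 0 < d.
Hypothesis a_ge : forall n, n%:R * d <= a n.

(** The wave starts from 0 with a jump of 1, then each switch between 1 and -1 has size 2. *)
Definition jump n : R := (-1) ^+ n * (if n == 0%N then 1 else 2).

Definition wave F N t := \sum_(n < N) jump n * step F (a n) t.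

(* The infinite wave: the copies with index beyond the cutoff start after [t]. *)
Definition train F t := wave F (Num.trunc (t / d)).+1 t.

Lemma wave_stable F N M t : t < a N -> (N <= M)%N -> wave F M t = wave F N t.
Proof.
move=> tN NM; rewrite /wave -(subnKC NM) big_split_ord /= [X in _ + X]big1 ?addr0//.
move=> i _; rewrite step_lt ?mulr0//; apply: lt_le_trans tN _.
by apply: a_le; rewrite leq_addr.
Qed.

Lemma lt_a_trunc t : t < a (Num.trunc (t / d)).+1.
Proof. by apply: lt_le_trans (a_ge _); rewrite -ltr_pdivrMr// truncnS_gt. Qed.

(** It allows one cutoff to be frozen on a whole interval, which reduces statements on [train] to
    finite sums. *)
Lemma trainE F N t : t < a N -> train F t = wave F N t.
Proof.
move=> tN; rewrite /train.
case: (leqP N (Num.trunc (t / d)).+1) => h; first exact: wave_stable.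
by symmetry; apply: wave_stable (ltnW h); exact: lt_a_trunc.
Qed.

Lemma waveS F N t : wave F N.+1 t = wave F N t + jump N * step F (a N) t.
Proof. by rewrite /wave big_ord_recr. Qed.

Lemma sum_jump N : \sum_(n < N.+1) jump n = (-1) ^+ N.
Proof.
elim: N => [|N IH]; first by rewrite big_ord1 /jump expr0 mulr1.
by rewrite big_ord_recr /= IH /jump exprS /=; ring.
Qed.

(** Once the last step is active all are, and the jumps sum to 1 or -1; before that, the last step
    contributes nothing. *)
Lemma wave_cst1_le1 N t : `|wave (fun=> 1) N t| <= 1.
Proof.
elim: N => [|N IH]; first by rewrite /wave big_ord0 normr0.
case: (ltP t (a N)) => h; first by rewrite waveS step_lt// mulr0 addr0.
rewrite (_ : wave _ _ _ = (-1) ^+ N) ?normrX ?normrN1 ?expr1n//.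
rewrite -sum_jump; apply: eq_bigr => i _; rewrite step_ge ?mulr1//.
by apply: le_trans h; apply: a_le; rewrite -ltnS.
Qed.

Lemma wave_integrable F N s t : (forall r, {for r, continuous F}) ->
  mu.-integrable `[s, t] (EFin \o wave F N).
Proof.
move=> cF; elim: N => [|N IH].
  rewrite (_ : _ \o _ = cst 0%E); first exact: integrable0.
  by apply/funext => r /=; rewrite /wave big_ord0.
rewrite (_ : wave F N.+1 = fun r => wave F N r + jump N * step F (a N) r); last first.
  by apply/funext => r; rewrite waveS.
have i2 : mu.-integrable `[s, t] (EFin \o (fun r => jump N * step F (a N) r)).
  exact: (integrableZl _ (jump N) (step_integrable _ _ _ cF)).
exact: (integrableD _ IH i2).
Qed.

Lemma is_primitive_wave F f N : F 0 = 0 -> (forall r : R, is_derive r 1 F (f r)) ->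
  (forall r, {for r, continuous f}) -> is_primitive (wave F N) (wave f N).
Proof.
move=> F0 dF cf; elim: N => [|N IH].
  have E h : wave h 0 = cst 0 by apply/funext => r; rewrite /wave big_ord0.
  move=> s t _ _; rewrite !E; split; first exact: integrable0.
  by rewrite /Rintegral integral0 subrr.
have E h : wave h N.+1 = fun r => wave h N r + jump N * step h (a N) r.
  by apply/funext => r; rewrite waveS.
by rewrite !E; apply: is_primitive_lin => //; exact: is_primitive_step.
Qed.

Lemma is_primitive_train F f : F 0 = 0 -> (forall r : R, is_derive r 1 F (f r)) ->
  (forall r, {for r, continuous f}) -> is_primitive (train F) (train f).
Proof.
move=> F0 dF cf s t s0 st; set N := (Num.trunc (t / d)).+1.
have tN : t < a N := lt_a_trunc t.
have [i e] := is_primitive_wave N F0 dF cf s0 st.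
have fE r : r \in `[s, t]%classic -> wave f N r = train f r.
  rewrite inE /= in_itv /= => /andP[_ rt]; symmetry; apply: trainE.
  exact: le_lt_trans tN.
split.
  by apply: eq_integrable i => // r /fE /= ->.
rewrite (trainE _ tN) (trainE _ (le_lt_trans st tN)) e.
exact: eq_Rintegral.
Qed.

Lemma is_derive_wave F f N t : F 0 = 0 -> f 0 = 0 ->
  (forall r : R, is_derive r 1 F (f r)) -> is_derive t 1 (wave F N) (wave f N t).
Proof.
move=> F0 f0 dF; elim: N => [|N IH].
  rewrite /wave big_ord0 (_ : (fun _ => _) = cst 0); first exact: is_derive_cst.
  by apply/funext => r; rewrite big_ord0.
rewrite (_ : wave F N.+1 = fun r => wave F N r + jump N * step F (a N) r); last first.
  by apply/funext => r; rewrite waveS.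
rewrite waveS; derE; [exact: IH|exact: (is_derive_step _ _ F0 f0 dF)|ring].
Qed.

Lemma is_derive_train F f t : F 0 = 0 -> f 0 = 0 ->
  (forall r : R, is_derive r 1 F (f r)) -> is_derive t 1 (train F) (train f t).
Proof.
move=> F0 f0 dF; have tN := lt_a_trunc t.
rewrite (trainE _ tN); apply: near_eq_is_derive (is_derive_wave _ _ F0 f0 dF).
near=> r; rewrite (@trainE _ (Num.trunc (t / d)).+1)//.
by near: r; exact: lt_nbhsl.
Unshelve. all: by end_near. Qed.

(** The response to the constant forcing 1 from zero initial data: integrating the equation of [G]
    expresses the primitive of [G] in this form. *)
Definition step_response t := (1 - G1 t - c * G t) / b.

Lemma is_derive_step_response t : is_derive t 1 step_response (G t).
Proof.
case: GP => _ _ dG dG1; rewrite /step_response.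
by derE; [exact: dG1|exact: dG|field].
Qed.

Lemma step_response0 : step_response 0 = 0.
Proof. by case: GP => G0 G10 _ _; rewrite /step_response G0 G10; ring. Qed.

Lemma train_solution :
  is_solution b c (train (fun=> 1)) (train step_response).
Proof.
have [G0 G10 dG dG1] := GP.
have dT t := is_derive_train t step_response0 G0 is_derive_step_response.
have dTE : derive1 (train step_response) = train G.
  by apply/funext => t; rewrite derive1E; have [_ ->] := dT t.
split; first by move=> t _; have [] := dT t.
exists (train G1); split.
  by rewrite dTE; apply: is_primitive_train => // r; exact: is_derive_continuous (dG1 r).
apply: aeW => t _; rewrite dTE /train /wave !mulr_sumr -!big_split /=.
apply: eq_bigr => i _; rewrite /step; case: ifP => _; last by ring.
by rewrite /step_response; field.
Qed.

Lemma train_admissible : admissible_forcing (train (fun=> 1)).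
Proof.
split; last first.
  apply: le_lt_trans (ltry 1); apply: ess_limsup_abs_le => // r.
  exact: wave_cst1_le1.
move=> T T0; set N := (Num.trunc (T / d)).+1.
have : mu.-integrable `]0, T[ (EFin \o wave (fun=> 1) N).
  have H : mu.-integrable `[0, T] (EFin \o wave (fun=> 1) N).
    by apply: wave_integrable => r; exact: cvg_cst.
  by apply: integrableS H => //; apply: subset_itvW; rewrite bnd_simp.
apply: eq_integrable => // r; rewrite inE /= in_itv /= => /andP[_ rT].
by rewrite (@trainE _ N)//; apply: lt_trans rT (lt_a_trunc _).
Qed.

(** For a forcing bounded by 1, the response has derivative [train G], so the bound is at least any
    value that these alternating sums reach in absolute value at arbitrarily late times. *)
Lemma velocity_bound_lower (L k : R) : 0 < L ->
  (forall A : R, exists N (t : R), [/\ A < t, a N <= t < a N.+1 &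
     L <= `|\sum_(n < N.+1) jump n * G (t - a n)|]) ->
  velocity_bound b c k -> L <= k.
Proof.
move=> L0 LP kP.
have [G0 G10 dG dG1] := GP.
have dTE : derive1 (train step_response) = train G.
  apply/funext => t; rewrite derive1E.
  by have [_ ->] := is_derive_train t step_response0 G0 is_derive_step_response.
have := kP _ _ train_admissible train_solution; rewrite dTE.
have LT : (L%:E <= limsup_abs (train G))%E.
  apply: limsup_abs_ge => A; have [N [t [At /andP[Nt tN] Lt]]] := LP A.
  exists t => //; rewrite (trainE _ tN); apply: le_trans Lt _.
  rewrite le_eqVlt; apply/orP; left; apply/eqP; congr `|_|.
  apply: eq_bigr => i _; rewrite step_ge//; apply: le_trans Nt.
  by apply: a_le; rewrite -ltnS.
have f1 : (ess_limsup_abs (train (fun=> 1%R)) <= 1%:E)%E.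
  by apply: ess_limsup_abs_le => // r; exact: wave_cst1_le1.
have f0 : (0 <= ess_limsup_abs (train (fun=> 1%R)))%E.
  rewrite ess_limsup_absE; apply: le_ereal_inf_tmp => _ [T _ <-].
  exact: tail_Linfty_norm_ge0.
(* A negative [k] would make the right-hand side at most 0, against [L > 0]. *)
move=> /(le_trans LT) h; have [k0|k0] := leP 0 k.
  by rewrite -lee_fin; apply: le_trans h _; rewrite -[leRHS]mule1 lee_wpmul2l ?lee_fin.
have : (k%:E * ess_limsup_abs (train (fun=> 1%R)) <= 0)%E.
  by rewrite mule_le0_ge0// lee_fin ltW.
by move=> /(le_trans h); rewrite lee_fin leNgt L0.
Qed.

End SquareWave.

(** * Optimality *)

Section Optimality.
Context {R : realType}.
Implicit Types (b c K L k r t x y : R).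

Definition is_optimal_bound b c K :=
  velocity_bound b c K /\ forall k, velocity_bound b c k -> K <= k.

Lemma optimal_velocity_boundE b c K : is_optimal_bound b c K ->
  optimal_velocity_bound b c = K.
Proof.
move=> [Kv Km]; apply/eqP; rewrite eq_le; apply/andP; split.
  by apply: ge_inf => //; exists K => k /Km.
by apply: lb_le_inf; [exists K|move=> k /Km].
Qed.

Lemma le_of_lt_approx K k : 0 < K -> (forall L, 0 < L -> L < K -> L <= k) -> K <= k.
Proof.
move=> K0 h; rewrite leNgt; apply/negP => kK.
have : Num.max (K / 2) ((k + K) / 2) <= k.
  by apply: h; [rewrite lt_max divr_gt0|rewrite gt_max; apply/andP; split; lra].
rewrite ge_max => /andP[_]; lra.
Qed.

Lemma nat_gt (A P : R) : 0 < P -> exists N : nat, forall n, (N <= n)%N -> A < n%:R * P.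
Proof.
move=> P0; exists (Num.trunc (A / P)).+1 => n Nn.
rewrite -ltr_pdivrMr//; apply: lt_le_trans (truncnS_gt _) _.
by rewrite ler_nat.
Qed.

Lemma sum_pairs (F : nat -> R) N :
  \sum_(n < N.*2) F n = \sum_(m < N) (F m.*2 + F m.*2.+1).
Proof.
elim: N => [|N IH]; first by rewrite !big_ord0.
by rewrite doubleS !big_ord_recr /= IH addrA.
Qed.

(** * Optimal bound when [G'] changes sign once *)

Section SingleSignChange.
Variables (b c : R) (G G1 : R -> R) (t0 : R).
Hypothesis b0 : b != 0.
Hypothesis GP : fundamental_solution b c G G1.
Hypothesis G_vanishing : vanishing G.
Hypothesis G1_vanishing : vanishing G1.
Hypothesis t0_gt0 : 0 < t0.
Hypothesis G_ge0 : forall t, 0 <= t -> 0 <= G t.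
Hypothesis G1_ge0 : forall t, 0 <= t <= t0 -> 0 <= G1 t.
Hypothesis G1_le0 : forall t, t0 <= t -> G1 t <= 0.
Hypothesis Gt0_gt0 : 0 < G t0.

Lemma single_nondecreasing x y : 0 <= x -> x <= y -> y <= t0 -> G x <= G y.
Proof.
case: GP => _ _ dG _ x0 xy yt.
apply: (derive_ge0_le xy (fun t _ => dG t)) => z /andP[z1 z2].
by apply: G1_ge0; lra.
Qed.

Lemma single_nonincreasing x y : t0 <= x -> x <= y -> G y <= G x.
Proof.
case: GP => _ _ dG _ x0 xy; rewrite -lerN2.
apply: (@derive_ge0_le _ (fun t => - G t) (fun t => - G1 t) _ _ xy).
by move=> z /andP[z1 z2]; rewrite oppr_ge0 G1_le0//; lra.
Qed.

(** [G] climbs from 0 to [G t0], then descends while staying nonnegative: each phase costs at most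
    [G t0]. *)
Lemma single_variation : variation_bound G G1 (2 * G t0).
Proof.
have [G0 _ _ _] := GP.
move=> phi M r r0 M0 H.
have up x : 0 <= x -> x <= r -> x <= t0 -> `|phi x - phi 0| <= M * G x.
  move=> x0 xr xt; have := H 1 0 x (lexx _) x0 xr.
  rewrite expr1n !mul1r G0 subr0; apply=> // z /andP[z0 zx].
  by rewrite mul1r; apply: G1_ge0; lra.
have [rt|tr] := leP r t0.
  apply: le_trans (up r r0 (lexx _) rt) _; apply: ler_wpM2l => //.
  apply: le_trans (single_nondecreasing r0 rt (lexx _)) _.
  by rewrite ler_peMl ?ler1n// ltW.
have h1 := up t0 (ltW t0_gt0) (ltW tr) (lexx _).
have h2 : `|phi r - phi t0| <= M * (G t0 - G r).
  have := H (-1) t0 r (ltW t0_gt0) (ltW tr) (lexx _).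
  rewrite sqrrN expr1n mulN1r opprB; apply=> // z /andP[z0 zx].
  by rewrite mulN1r oppr_ge0 G1_le0.
rewrite -(subrKA (phi t0)); apply: le_trans (ler_normD _ _) _.
have h3 : 0 <= M * G r by rewrite mulr_ge0// G_ge0.
by lra.
Qed.

(* A square wave equal to [-1] on [(m P, m P + P - t0)] and [1] on the rest of each
   long period [P], up to a global sign, almost realizes the total variation of [G]
   at the times [N P]. *)
Lemma single_lower k : velocity_bound b c k -> 2 * G t0 <= k.
Proof.
have [G0 _ _ _] := GP; have t0p := t0_gt0; have Gp := Gt0_gt0.
move=> kP; apply: le_of_lt_approx => [|L L0 LK]; first by rewrite mulr_gt0.
have [A hA] : exists A, forall t, A <= t -> `|G t| <= (2 * G t0 - L) / 2.
  by apply: G_vanishing; lra.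
(* [P >= A] makes [G P] small, and [P >= 2 t0] gives [a n >= n P / 2] for the switching times
   below. *)
have [P PA Pt] : exists2 P, A <= P & 2 * t0 <= P.
  by exists (Num.max A (2 * t0)); rewrite le_max lexx ?orbT.
have P0 : 0 < P by apply: lt_le_trans Pt; rewrite mulr_gt0.
pose a n : R := (n./2)%:R * P + (if odd n then P - t0 else 0).
have aE m : a m.*2 = m%:R * P by rewrite /a doubleK odd_double addr0.
have aO m : a m.*2.+1 = m%:R * P + (P - t0).
  by rewrite /a /= odd_double /= uphalf_double.
have aS n : a n <= a n.+1.
  rewrite -(odd_double_half n); case: (odd n) => /=.
    rewrite add1n -doubleS aO aE -natr1; lra.
  by rewrite add0n aO aE; lra.
have a_le n m : (n <= m)%N -> a n <= a m.
  by move=> /subnKC <-; elim: (m - n)%N => [|i IH]; rewrite ?addn0// addnS (le_trans IH).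
have a_ge n : n%:R * (P / 2) <= a n.
  rewrite -(odd_double_half n); case: (odd n) => /=.
    rewrite add1n aO -natr1 -muln2 natrM; lra.
  by rewrite add0n aE -muln2 natrM; lra.
apply: (velocity_bound_lower b0 GP a_le (divr_gt0 P0 _) a_ge L0) kP => // B.
have [N0 hN] := nat_gt B P0.
exists N0.+1.*2, (N0.+1%:R * P); split; first exact: hN.
  by rewrite aE lexx aO /=; lra.
rewrite -normrN; apply: le_trans (ler_norm _).
rewrite big_ord_recr /= aE subrr G0 mulr0 addr0.
rewrite (sum_pairs (fun n => jump n * G (N0.+1%:R * P - a n))).
(* Pairing the two switches of each period. The very first jump is 1 instead of 2, which [G >= 0]
   absorbs. *)
rewrite lerNr; apply: (@le_trans _ _ (\sum_(m < N0.+1) 2 * (G ((N0.+1 - m)%:R * P) -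
  G ((N0 - m)%:R * P + t0)))).
  apply: ler_sum => m _; rewrite aE aO.
  have mN : (m <= N0)%N by rewrite -ltnS.
  have -> : N0.+1%:R * P - m%:R * P = (N0.+1 - m)%:R * P.
    by rewrite natrB ?mulrBl// ltnW.
  have -> : N0.+1%:R * P - (m%:R * P + (P - t0)) = (N0 - m)%:R * P + t0.
    by rewrite natrB// -natr1; ring.
  have h : 0 <= G ((N0.+1 - m)%:R * P) by apply: G_ge0; rewrite mulr_ge0// ltW.
  have -> : jump (val m).*2.+1 = - 2 :> R.
    by rewrite /jump /= exprS -mul2n exprM sqrrN expr1n expr1n; ring.
  rewrite /jump -mul2n exprM sqrrN expr1n expr1n.
  by case: ifP => _; lra.
(* The last pair, [2 (G P - G t0)], is the main term. The earlier pairs are nonpositive because [G]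
   decreases after [t0]. *)
rewrite big_ord_recr /= subnn mul0r add0r subSnn mul1r.
have h1 : G P <= (2 * G t0 - L) / 2 by apply: le_trans (ler_norm _) (hA _ PA).
suff : \sum_(m < N0) 2 * (G ((N0.+1 - m)%:R * P) - G ((N0 - m)%:R * P + t0)) <= 0 by lra.
apply: sumr_le0 => m _; rewrite pmulr_rle0// subr_le0.
have mN : (0 < N0 - m)%N by rewrite subn_gt0.
rewrite subSn; last by rewrite ltnW.
rewrite -natr1 mulrDl mul1r; apply: single_nonincreasing; last by rewrite lerD2l; lra.
by rewrite lerDr mulr_ge0// ltW.
Qed.

Lemma single_optimal : is_optimal_bound b c (2 * G t0).
Proof.
split; last exact: single_lower.
apply: (velocity_bound_of_variation GP) => //; first exact: single_variation.
by rewrite mulr_gt0.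
Qed.

End SingleSignChange.

(** * Optimal bound when [G'] changes sign periodically *)

Section PeriodicSignChange.
Variables (b c : R) (G G1 : R -> R) (t0 h q : R).
Hypothesis b0 : b != 0.
Hypothesis GP : fundamental_solution b c G G1.
Hypothesis G_vanishing : vanishing G.
Hypothesis G1_vanishing : vanishing G1.
Hypothesis t0h : 0 < t0 < h.
Hypothesis q01 : 0 < q < 1.
Hypothesis G_shift : forall t, G (t + h) = - q * G t.
Hypothesis G1_shift : forall t, G1 (t + h) = - q * G1 t.
Hypothesis G1_ge0 : forall t, 0 <= t <= t0 -> 0 <= G1 t.
Hypothesis G1_le0 : forall t, t0 <= t <= t0 + h -> G1 t <= 0.
Hypothesis Gt0_gt0 : 0 < G t0.

Lemma periodic_shiftn t n : G (t + n%:R * h) = (- q) ^+ n * G t.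
Proof.
elim: n => [|n IH]; first by rewrite mul0r addr0 expr0 mul1r.
by rewrite -natr1 mulrDl mul1r addrA G_shift IH exprS; ring.
Qed.

Lemma periodic_sign n t : t0 + n%:R * h <= t <= t0 + n.+1%:R * h ->
  0 <= (-1) ^+ n.+1 * G1 t.
Proof.
have /andP[q0 q1] := q01.
elim: n t => [|n IH] t ht.
  rewrite expr1 mulN1r oppr_ge0; apply: G1_le0; move: ht; lra.
have -> : t = (t - h) + h by ring.
have : t0 + n%:R * h <= t - h <= t0 + n.+1%:R * h by move: ht; rewrite -!natr1; lra.
move=> /IH IHt; rewrite G1_shift exprS.
have -> : -1 * (-1) ^+ n.+1 * (- q * G1 (t - h)) = q * ((-1) ^+ n.+1 * G1 (t - h)) by ring.
by rewrite mulr_ge0// ltW.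
Qed.

(** The extrema of [G] are [(- q)^n G t0] at [t0 + n h], so the successive variations
    [q^n (1 + q) G t0] form a geometric series. *)
Lemma periodic_variation : variation_bound G G1 (2 * G t0 / (1 - q)).
Proof.
have /andP[q0 q1] := q01; have /andP[t00 t0h'] := t0h.
have [G0 _ dG _] := GP; have Gp := Gt0_gt0; have h0 : 0 < h by apply: lt_trans t0h'.
have q1' : 0 < 1 - q by lra.
move=> phi M r r0 M0 H.
have up x : 0 <= x -> x <= r -> x <= t0 -> `|phi x - phi 0| <= M * G t0.
  move=> x0 xr xt; have := H 1 0 x (lexx _) x0 xr.
  rewrite expr1n !mul1r G0 subr0 => /(_ erefl) h1.
  apply: (@le_trans _ _ (M * G x)).
    by apply: h1 => z /andP[z0 zx]; rewrite mul1r G1_ge0//; lra.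
  apply: ler_wpM2l => //; apply: (derive_ge0_le xt (fun t _ => dG t)) => z /andP[z1 z2].
  by apply: G1_ge0; lra.
(* Variation of [G] from 0 up to its extremum at [t0 + n h]. *)
pose B n := G t0 * (2 - q ^+ n * (1 + q)) / (1 - q).
have BS n : B n.+1 = B n + q ^+ n * (1 + q) * G t0.
  by rewrite /B exprS; field; rewrite gt_eqF.
have BK n : M * B n <= M * (2 * G t0 / (1 - q)).
  apply: ler_wpM2l => //; rewrite /B ler_pM2r ?invr_gt0// [2 * _]mulrC ler_pM2l//.
  by rewrite gerBl mulr_ge0 ?exprn_ge0 ?ltW//; lra.
have piece n x : t0 + n%:R * h <= x -> x <= t0 + n.+1%:R * h -> x <= r ->
    `|phi x - phi (t0 + n%:R * h)| <= M * (q ^+ n * (1 + q) * G t0).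
  move=> nx xn xr.
  have := H ((-1) ^+ n.+1) (t0 + n%:R * h) x _ nx xr.
  rewrite -exprM mulnC exprM sqrrN expr1n expr1n => H'.
  apply: (@le_trans _ _ (M * ((-1) ^+ n.+1 * (G x - G (t0 + n%:R * h))))).
    apply: H' => //; first by rewrite addr_ge0 ?mulr_ge0 ?(ltW t00) ?(ltW h0).
    by move=> z /andP[z1 z2]; apply: periodic_sign; rewrite z1 (le_trans z2).
  apply: ler_wpM2l => //.
  have : (-1) ^+ n.+1 * G x <= (-1) ^+ n.+1 * G (t0 + n.+1%:R * h).
    apply: (@derive_ge0_le _ (fun t => (-1) ^+ n.+1 * G t)
      (fun t => (-1) ^+ n.+1 * G1 t) _ _ xn).
    by move=> z /andP[z1 z2]; apply: periodic_sign; rewrite (ltW z2) (le_trans nx)// ltW.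
  rewrite mulrBr !periodic_shiftn !(exprNn q).
  have s1 : (-1) ^+ n.+1 * ((-1) ^+ n.+1 * q ^+ n.+1 * G t0) = q ^+ n.+1 * G t0.
    by rewrite !mulrA -expr2 -exprM mulnC exprM sqrrN !expr1n mul1r.
  have s2 : (-1) ^+ n.+1 * ((-1) ^+ n * q ^+ n * G t0) = - (q ^+ n * G t0).
    by rewrite exprS !mulrA -[-1 * _ * _]mulrA -expr2 -exprM mulnC exprM sqrrN !expr1n; ring.
  by rewrite s1 s2 [q ^+ n.+1]exprS; lra.
have knots n : t0 + n%:R * h <= r -> `|phi (t0 + n%:R * h) - phi 0| <= M * B n.
  elim: n => [|n IH] nr.
    rewrite mul0r addr0 in nr *; apply: le_trans (up _ (ltW t00) nr (lexx _)) _.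
    rewrite /B expr0 le_eqVlt; apply/orP; left; apply/eqP.
    by field; rewrite gt_eqF.
  have n1 : t0 + n%:R * h <= t0 + n.+1%:R * h by rewrite -natr1; lra.
  rewrite -(subrKA (phi (t0 + n%:R * h))); apply: le_trans (ler_normD _ _) _.
  rewrite addrC BS mulrDr; apply: lerD; last exact: piece.
  by apply: IH; apply: le_trans nr.
have [rt|tr] := leP r t0.
  apply: le_trans (up r r0 (lexx _) rt) _; apply: ler_wpM2l => //.
  by rewrite ler_pdivlMr//; nra.
pose n := Num.trunc ((r - t0) / h).
have /andP[n1 n2] : n%:R <= (r - t0) / h < n.+1%:R.
  by apply: truncn_itv; rewrite divr_ge0 ?subr_ge0 ?ltW.
rewrite ler_pdivlMr// in n1; rewrite ltr_pdivrMr// in n2.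
have nr : t0 + n%:R * h <= r by lra.
rewrite -(subrKA (phi (t0 + n%:R * h))); apply: le_trans (ler_normD _ _) _.
apply: le_trans (BK n.+1); rewrite addrC BS mulrDr; apply: lerD; first exact: knots.
by apply: piece => //; lra.
Qed.

(** The wave switches every [h], in resonance with [G]: at [t0 + N h] all terms have the sign of
    [(-1)^N], and their sum has the modulus of the variation of [G] up to that time. *)
Lemma periodic_lower k : velocity_bound b c k -> 2 * G t0 / (1 - q) <= k.
Proof.
have /andP[q0 q1] := q01; have /andP[t00 t0h'] := t0h.
have h0 : 0 < h by apply: lt_trans t0h'.
have q1' : 0 < 1 - q by lra.
have Gp := Gt0_gt0.
move=> kP; apply: le_of_lt_approx => [|L L0 LK]; first by rewrite divr_gt0// mulr_gt0.
pose a n : R := n%:R * h.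
have a_le n m : (n <= m)%N -> a n <= a m by move=> nm; rewrite ler_pM2r// ler_nat.
apply: (velocity_bound_lower b0 GP a_le h0 (fun n => lexx _) L0) kP => A.
have [N1 hN1] := nat_gt A h0.
(* As [1 + q < 2], having [q^N <= e] makes the sum at least [L]. *)
pose e := (2 * G t0 - L * (1 - q)) / (2 * G t0).
have e0 : 0 < e.
  rewrite divr_gt0 ?mulr_gt0// subr_gt0 -ltr_pdivlMr//.
have [N2 _ hN2] : \forall n \near \oo, `|q ^+ n| <= e.
  have : q ^+ n @[n --> \oo] --> (0 : R) by apply: cvg_expr; rewrite gtr0_norm.
  by move=> /cvgrPdist_le /(_ _ e0); apply: filterS => n; rewrite sub0r normrN.
pose N := maxn N1 N2.
exists N, (t0 + N%:R * h); split.
- by apply: lt_trans (hN1 N (leq_maxl _ _)) _; rewrite ltrDr.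
- by rewrite /a -natr1; lra.
have SE n : \sum_(i < n.+1) jump i * G (t0 + n%:R * h - a i) =
    (-1) ^+ n * (G t0 * (2 - q ^+ n * (1 + q)) / (1 - q)).
  elim: n => [|n IH].
    rewrite big_ord1 /jump /a !mul0r addr0 subr0 !expr0 !mul1r; field.
    by rewrite gt_eqF.
  rewrite big_ord_recr /= /a addrK.
  transitivity (- q * (\sum_(i < n.+1) jump i * G (t0 + n%:R * h - a i)) + jump n.+1 * G t0).
    congr (_ + _); rewrite mulr_sumr; apply: eq_bigr => i _.
    have -> : t0 + n.+1%:R * h - i%:R * h = t0 + n%:R * h - a i + h by rewrite /a -natr1; ring.
    by rewrite G_shift; ring.
  rewrite IH /jump /= !exprS; field; by rewrite gt_eqF.
rewrite SE normrM normrX normrN1 expr1n mul1r; apply: le_trans (ler_norm _).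
rewrite ler_pdivlMr//.
have : q ^+ N <= e by apply: le_trans (ler_norm _) (hN2 N (leq_maxr _ _)).
rewrite /e ler_pdivlMr ?mulr_gt0// => hq.
have Q0 : 0 <= q ^+ N by rewrite exprn_ge0// ltW.
have := mulr_ge0 (mulr_ge0 (ltW Gp) Q0) (ltW q1').
move: hq; move: (q ^+ N) => Q; lra.
Qed.

Lemma periodic_optimal : is_optimal_bound b c (2 * G t0 / (1 - q)).
Proof.
have /andP[q0 q1] := q01.
split; last exact: periodic_lower.
apply: (velocity_bound_of_variation GP) => //; first exact: periodic_variation.
by rewrite divr_gt0 ?mulr_gt0 ?subr_gt0.
Qed.

End PeriodicSignChange.
End Optimality.

(** * Fundamental solutions in the three regimes *)

Section Kernels.
Context {R : realType}.
Implicit Types (a b c d p r s t x y z A C : R) (F : R -> R).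

(** The factor [1 + t] accommodates the double root; it is beaten by [exp (a t) >= (a t / 2)^2]. *)
Lemma vanishing_expR a C F : 0 < a -> 0 < C ->
  (forall t, 0 <= t -> `|F t| <= C * (1 + t) * expR (- (a * t))) -> vanishing F.
Proof.
move=> a0 C0 FC e e0; exists (1 + 8 * C / (a ^+ 2 * e)) => t.
have a2 : 0 < a ^+ 2 by rewrite exprn_gt0.
have h : 0 < 8 * C / (a ^+ 2 * e) by rewrite divr_gt0 ?mulr_gt0.
move=> At; have t1 : 1 < t by lra.
have t0 : 0 < t by lra.
apply: le_trans (FC t (ltW t0)) _.
rewrite expRN ler_pdivrMr ?expR_gt0//.
have At' : 8 * C <= t * (a ^+ 2 * e) by rewrite -ler_pdivrMr ?mulr_gt0//; lra.
have hE : (a * t / 2) ^+ 2 <= expR (a * t).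
  have -> : a * t = a * t / 2 + a * t / 2 by field.
  rewrite expRD -expr2; have := @expR_ge1Dx R (a * t / 2) => hx.
  have -> : (a * t / 2 + a * t / 2) / 2 = a * t / 2 by field.
  have : 0 < a * t / 2 by rewrite divr_gt0// mulr_gt0.
  by move=> hp; rewrite ler_sqr ?nnegrE ?expR_ge0//; lra.
apply: (@le_trans _ _ (e * (a * t / 2) ^+ 2)); last by rewrite ler_pM2l.
apply: (@le_trans _ _ (C * (2 * t))); first by rewrite ler_pM2l//; lra.
have -> : e * (a * t / 2) ^+ 2 = (t * (a ^+ 2 * e)) * t / 4 by field.
have := ler_wpM2r (ltW t0) At'; lra.
Qed.

(** The characteristic roots are [- p] and [- r]; [t0] is the only zero of [G']. *)
Lemma overdamped_optimal p r : 0 < p -> p < r ->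
  is_optimal_bound (p * r) (p + r)
    (2 * (expR (- (p * (ln (r / p) / (r - p)))) / r)).
Proof.
move=> p0 pr; have r0 : 0 < r by apply: lt_trans pr.
have s0 : 0 < r - p by rewrite subr_gt0.
pose G t := (expR (- (p * t)) - expR (- (r * t))) / (r - p).
pose G1 t := (r * expR (- (r * t)) - p * expR (- (p * t))) / (r - p).
set t0 := ln (r / p) / (r - p).
have lt0 : 0 < ln (r / p) by rewrite ln_gt0// ltr_pdivlMr// mul1r.
have t00 : 0 < t0 by rewrite divr_gt0.
have rp : p * expR ((r - p) * t0) = r.
  have -> : (r - p) * t0 = ln (r / p) by rewrite /t0; field; rewrite gt_eqF.
  by rewrite lnK ?posrE ?divr_gt0//; field; rewrite gt_eqF.
(* Factoring out [expR (- (r * t))] reduces the sign of [G1] to comparing [p expR ((r - p) t)] with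
   [r], its value at [t0]. *)
have E t : expR (- (p * t)) = expR (- (r * t)) * expR ((r - p) * t).
  by rewrite -expRD; congr expR; ring.
have Gt0 : G t0 = expR (- (p * t0)) / r.
  rewrite /G E -[X in _ = _ / X]rp.
  have := expR_gt0 ((r - p) * t0); have rp' := rp.
  move: (expR ((r - p) * t0)) rp' => X rp' X0; rewrite -rp'.
  by field; rewrite rp' !gt_eqF.
rewrite -Gt0.
apply: (@single_optimal _ _ _ G G1).
- by rewrite gt_eqF// mulr_gt0.
- split.
  + by rewrite /G !mulr0 subrr mul0r.
  + by rewrite /G1 !mulr0 oppr0 expR0 !mulr1 divff// gt_eqF.
  + by move=> t; rewrite /G /G1; derE; field; rewrite gt_eqF.
  + by move=> t; rewrite /G /G1; derE; field; rewrite gt_eqF.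
- apply: (@vanishing_expR p (2 / (r - p))) => //; first by rewrite divr_gt0.
  move=> t tp; rewrite /G normrM normfV (gtr0_norm s0).
  rewrite -mulrA [leRHS]mulrAC ler_pM2r ?invr_gt0//.
  apply: le_trans (ler_normB _ _) _; rewrite !gtr0_norm ?expR_gt0//.
  have : expR (- (r * t)) <= expR (- (p * t)).
    by rewrite ler_expR lerN2; apply: ler_wpM2r => //; exact: ltW.
  have := expR_gt0 (- (p * t)); nra.
- apply: (@vanishing_expR p (2 * r / (r - p))) => //; first by rewrite divr_gt0 ?mulr_gt0.
  move=> t tp; rewrite /G1 normrM normfV (gtr0_norm s0).
  rewrite -mulrA [leRHS]mulrAC ler_pM2r ?invr_gt0//.
  apply: le_trans (ler_normB _ _) _; rewrite !gtr0_norm ?mulr_gt0 ?expR_gt0//.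
  have h1 : expR (- (r * t)) <= expR (- (p * t)).
    by rewrite ler_expR lerN2; apply: ler_wpM2r => //; exact: ltW.
  have h2 := expR_gt0 (- (p * t)).
  have h3 : r * expR (- (r * t)) <= r * expR (- (p * t)) by rewrite ler_pM2l.
  have h4 : p * expR (- (p * t)) <= r * expR (- (p * t)) by rewrite ler_pM2r// ltW.
  have h5 : 0 <= r * expR (- (p * t)) * t by rewrite !mulr_ge0// ltW.
  lra.
- exact: t00.
- move=> t tp; rewrite /G divr_ge0 ?(ltW s0)// subr_ge0 ler_expR lerN2.
  by apply: ler_wpM2r => //; exact: ltW.
- move=> t /andP[tp tt]; rewrite /G1 divr_ge0 ?(ltW s0)// subr_ge0 E mulrCA.
  by rewrite [leRHS]mulrC ler_pM2l ?expR_gt0// -[leRHS]rp ler_pM2l// ler_expR ler_pM2l.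
- move=> t tt; rewrite /G1 pmulr_lle0 ?invr_gt0// subr_le0 E [p * _]mulrCA [leLHS]mulrC.
  by rewrite ler_pM2l ?expR_gt0// -[leLHS]rp ler_pM2l// ler_expR ler_pM2l.
- by rewrite Gt0 divr_gt0 ?expR_gt0.
Qed.

Lemma critical_optimal a : 0 < a -> is_optimal_bound (a ^+ 2) (2 * a) (2 * (expR (- 1) / a)).
Proof.
move=> a0.
pose G t := t * expR (- (a * t)).
pose G1 t := (1 - a * t) * expR (- (a * t)).
have Gt0 : G a^-1 = expR (- 1) / a by rewrite /G divff ?gt_eqF// mulrC.
rewrite -Gt0; apply: (@single_optimal _ _ _ G G1).
- by rewrite gt_eqF// exprn_gt0.
- split.
  + by rewrite /G mul0r.
  + by rewrite /G1 !mulr0 oppr0 expR0 addr0 mulr1.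
  + by move=> t; rewrite /G /G1; derE; ring.
  + by move=> t; rewrite /G /G1; derE; ring.
- apply: (@vanishing_expR a 1) => // t tp.
  rewrite /G normrM mul1r (gtr0_norm (expR_gt0 _)) ler_pM2r ?expR_gt0// ger0_norm//; lra.
- apply: (@vanishing_expR a (1 + a)) => //; first lra.
  move=> t tp; rewrite /G1 normrM (gtr0_norm (expR_gt0 _)) ler_pM2r ?expR_gt0//.
  apply: le_trans (ler_normB _ _) _; rewrite normr1 ger0_norm ?mulr_ge0 ?(ltW a0)//; nra.
- by rewrite invr_gt0.
- by move=> t tp; rewrite /G mulr_ge0 ?expR_ge0.
- move=> t /andP[tp tt]; rewrite /G1 mulr_ge0 ?expR_ge0// subr_ge0.
  by rewrite mulrC -ler_pdivlMr// mul1r.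
- move=> t tt; rewrite /G1 pmulr_lle0 ?expR_gt0// subr_le0.
  by rewrite mulrC -ler_pdivrMr// mul1r.
- by rewrite Gt0 divr_gt0 ?expR_gt0.
Qed.

(** The characteristic roots are [- a] plus or minus [i a d]; [G'] first vanishes at
    [atan d / (a d)], then every half period [pi / (a d)]. *)
Lemma underdamped_optimal a d : 0 < a -> 0 < d ->
  is_optimal_bound (a ^+ 2 * (1 + d ^+ 2)) (2 * a)
    (2 * (expR (- (atan d / d)) / (a * Num.sqrt (1 + d ^+ 2))) / osc_ratio d).
Proof.
move=> a0 d0; have d2 : 0 < 1 + d ^+ 2 by have := sqr_ge0 d; lra.
have p0 := pi_gt0 R.
pose w := a * d; have w0 : 0 < w by rewrite mulr_gt0.
pose th := atan d; have th0 : 0 < th by apply: lt_trans (atan_gt d0); rewrite divr_gt0.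
have thp : th < pi by have := atan_ltpi2 d; rewrite -/th; lra.
have sth : 0 < sin th by apply: sin_gt0_pi; rewrite th0.
have sthE : sin th = d * cos th.
  have := atanK d; rewrite /tan -/th => <-; rewrite divfK// gt_eqF//.
  by rewrite cos_gt0_pihalf// atan_gtNpi2 atan_ltpi2.
have sthd : sin th = d / Num.sqrt (1 + d ^+ 2).
  have sq : 0 < Num.sqrt (1 + d ^+ 2) by rewrite sqrtr_gt0.
  have sq2 : Num.sqrt (1 + d ^+ 2) ^+ 2 = 1 + d ^+ 2 by rewrite sqr_sqrtr ?ltW.
  apply: (canRL (mulfK _)); first by rewrite gt_eqF.
  apply: (@pexpIrn _ 2) => //; rewrite ?nnegrE ?mulr_ge0 ?(ltW sth) ?(ltW sq) ?(ltW d0)//.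
  have e : cos th ^+ 2 * (1 + d ^+ 2) = 1.
    by rewrite -[RHS](cos2Dsin2 th) sthE; ring.
  by rewrite exprMn sq2 sthE exprMn -mulrA e mulr1.
pose G t := expR (- (a * t)) * sin (w * t) / w.
pose G1 t := expR (- (a * t)) * (cos (w * t) - sin (w * t) / d).
pose t0 := th / w; pose h := pi / w.
have t00 : 0 < t0 by rewrite divr_gt0.
have h0 : 0 < h by rewrite divr_gt0.
have wt0 : w * t0 = th by rewrite /t0 mulrC divfK// gt_eqF.
have wh : w * h = pi by rewrite /h mulrC divfK// gt_eqF.
have at0 : a * t0 = th / d by rewrite /t0 /w; field; rewrite !gt_eqF.
have ah : a * h = pi / d by rewrite /h /w; move: pi => P; field; rewrite !gt_eqF.
have Gt0 : G t0 = expR (- (atan d / d)) / (a * Num.sqrt (1 + d ^+ 2)).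
  rewrite /G wt0 at0 sthd /w -/th; field.
  by rewrite !gt_eqF// sqrtr_gt0.
(* In phase form the sign of [G1] is read off the sine alone. *)
have G1E t : G1 t = expR (- (a * t)) * (sin (th - w * t) / sin th).
  rewrite /G1 sinB; congr (_ * _).
  have -> : cos th = sin th / d by rewrite sthE; field; rewrite gt_eqF.
  by field; rewrite !gt_eqF.
pose q := expR (- (pi / d)).
have -> : osc_ratio d = 1 - q by [].
rewrite -Gt0; apply: (@periodic_optimal _ _ _ G G1 t0 h q).
- by rewrite gt_eqF// mulr_gt0// exprn_gt0.
- split.
  + by rewrite /G !mulr0 sin0 mulr0 mul0r.
  + by rewrite /G1 !mulr0 oppr0 expR0 sin0 cos0 mul0r subr0 mulr1.
  + by move=> t; rewrite /G /G1 /w; derE; field; rewrite !gt_eqF.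
  + by move=> t; rewrite /G /G1 /w; derE; field; rewrite !gt_eqF.
- apply: (@vanishing_expR a w^-1); rewrite ?invr_gt0// => t tp.
  rewrite /G !normrM normfV (gtr0_norm w0) (gtr0_norm (expR_gt0 _)).
  rewrite [leLHS]mulrC -mulrA ler_pM2l ?invr_gt0// mulrC ler_pM2r ?expR_gt0//.
  by apply: le_trans (_ : 1 <= _); [rewrite ler_norml sin_geN1 sin_le1|lra].
- apply: (@vanishing_expR a (1 + d^-1)) => //; first by rewrite addr_gt0// invr_gt0.
  move=> t tp; rewrite /G1 normrM (gtr0_norm (expR_gt0 _)) mulrC ler_pM2r ?expR_gt0//.
  apply: le_trans (ler_normB _ _) _; rewrite normrM normfV (gtr0_norm d0).
  have dV : 0 < d^-1 by rewrite invr_gt0.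
  have c1 : `|cos (w * t)| <= 1 by rewrite ler_norml cos_geN1 cos_le1.
  have s1 : `|sin (w * t)| <= 1 by rewrite ler_norml sin_geN1 sin_le1.
  have := ler_wpM2r (ltW dV) s1; have := mulr_ge0 (ltW dV) tp; lra.
- by rewrite t00 ltr_pM2r ?invr_gt0.
- by rewrite expR_gt0 expR_lt1 oppr_lt0 divr_gt0.
- move=> t; rewrite /G !mulrDr wh ah opprD expRD sinDpi -/q; field.
  by rewrite gt_eqF.
- move=> t; rewrite /G1 !mulrDr wh ah opprD expRD sinDpi cosDpi -/q; field.
  by rewrite gt_eqF.
- move=> t /andP[tp tt]; rewrite G1E mulr_ge0 ?expR_ge0// divr_ge0 ?(ltW sth)//.
  have : w * t <= th by rewrite -wt0 ler_pM2l.
  have : 0 <= w * t by rewrite mulr_ge0// ltW.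
  by move=> x1 x2; apply: sin_ge0_pi; lra.
- move=> t /andP[t1 t2]; rewrite G1E pmulr_rle0 ?expR_gt0// pmulr_lle0 ?invr_gt0//.
  have : th <= w * t by rewrite -wt0 ler_pM2l.
  have : w * t <= th + pi by rewrite -wt0 -wh -mulrDr ler_pM2l.
  move=> x1 x2; rewrite -opprB sinN oppr_le0; apply: sin_ge0_pi; lra.
- by rewrite Gt0 divr_gt0 ?expR_gt0// mulr_gt0// sqrtr_gt0.
Qed.

End Kernels.

(** * The bound as a function of [4 b / c^2] *)

Section DampingProfiles.
Context {R : realType}.
Implicit Types (b c p x : R).

(* With [p = 4 b / c^2], the optimal bound is
   [4 / c * exp (log_bound_c p) = 2 / sqrt b * exp (log_bound_b p)]. *)
Definition log_bound_c p := if p < 1 then over_c (Num.sqrt (1 - p))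
  else if p == 1 then -1 else under_c (Num.sqrt (p - 1)).

Definition log_bound_b p := if p < 1 then over_b (Num.sqrt (1 - p))
  else if p == 1 then -1 else under_b (Num.sqrt (p - 1)).

Lemma sqrt_over p : 0 < p < 1 -> 0 < Num.sqrt (1 - p) < 1.
Proof.
move=> /andP[p0 p1]; rewrite sqrtr_gt0 subr_gt0 p1 /=.
by rewrite -[ltRHS]sqrtr1 ltr_sqrt//; lra.
Qed.

Lemma log_bound_c_over x : 0 < x < 1 -> log_bound_c (1 - x ^+ 2) = over_c x.
Proof.
move=> /andP[x0 x1]; rewrite /log_bound_c ltrBlDr ltrDl exprn_gt0//.
by rewrite subKr sqrtr_sqr gtr0_norm.
Qed.

Lemma log_bound_c_under x : 0 < x -> log_bound_c (1 + x ^+ 2) = under_c x.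
Proof.
move=> x0; have h : 1 < 1 + x ^+ 2 by rewrite ltrDl exprn_gt0.
rewrite /log_bound_c ltNge (ltW h) /= gt_eqF//.
by rewrite addrAC subrr add0r sqrtr_sqr gtr0_norm.
Qed.

(** The regimes are glued at the critical value: [over_c > -1 > under_c]. Below 1, Delta decreases
    with [p] while [over_c] increases with Delta. *)
Lemma log_bound_c_lt p x : 0 < p -> p < x -> log_bound_c x < log_bound_c p.
Proof.
move=> p0 px; rewrite /log_bound_c.
case: (ltgtP p 1) => p1.
- have hp : 0 < Num.sqrt (1 - p) < 1 by apply: sqrt_over; rewrite p0.
  case: (ltgtP x 1) => x1.
  + have hx : 0 < Num.sqrt (1 - x) < 1 by apply: sqrt_over; rewrite x1 (lt_trans p0).
    by apply: over_c_lt; [lra|rewrite ltr_sqrt; lra|lra].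
  + apply: (@lt_trans _ _ (-1)); last exact: over_c_gt_m1.
    by apply: under_c_lt_m1; rewrite sqrtr_gt0 subr_gt0.
  + exact: over_c_gt_m1.
- rewrite [x < 1]ltNge (ltW (lt_trans p1 px)) /= gt_eqF ?(lt_trans p1)//.
  apply: under_c_lt; first by rewrite sqrtr_gt0 subr_gt0.
  by rewrite ltr_sqrt; lra.
- have x1 : 1 < x by rewrite -p1.
  rewrite [x < 1]ltNge (ltW x1) /= gt_eqF//.
  by apply: under_c_lt_m1; rewrite sqrtr_gt0 subr_gt0.
Qed.

(** The same gluing with the order reversed: [over_b < -1 < under_b]. *)
Lemma log_bound_b_lt p x : 0 < p -> p < x -> log_bound_b p < log_bound_b x.
Proof.
move=> p0 px; rewrite /log_bound_b.
case: (ltgtP p 1) => p1.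
- have hp : 0 < Num.sqrt (1 - p) < 1 by apply: sqrt_over; rewrite p0.
  case: (ltgtP x 1) => x1.
  + have hx : 0 < Num.sqrt (1 - x) < 1 by apply: sqrt_over; rewrite x1 (lt_trans p0).
    by apply: over_b_lt; [lra|rewrite ltr_sqrt; lra|lra].
  + apply: (@lt_trans _ _ (-1)); first exact: over_b_lt_m1.
    by apply: under_b_gt; rewrite sqrtr_gt0 subr_gt0.
  + exact: over_b_lt_m1.
- rewrite [x < 1]ltNge (ltW (lt_trans p1 px)) /= gt_eqF ?(lt_trans p1)//.
  apply: under_b_lt; first by rewrite sqrtr_gt0 subr_gt0.
  by rewrite ltr_sqrt; lra.
- have x1 : 1 < x by rewrite -p1.
  rewrite [x < 1]ltNge (ltW x1) /= gt_eqF//.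
  by apply: under_b_gt; rewrite sqrtr_gt0 subr_gt0.
Qed.

Lemma log_bound_bE p : 0 < p -> log_bound_b p = log_bound_c p + ln p / 2.
Proof.
move=> p0; rewrite /log_bound_b /log_bound_c /over_c /under_c.
case: (ltgtP p 1) => p1.
- by rewrite sqr_sqrtr ?subKr ?subrK// subr_ge0 ltW.
- rewrite sqr_sqrtr ?subr_ge0 ?ltW//; have -> : 1 + (p - 1) = p by ring.
  by rewrite subrK.
- by rewrite p1 ln1 mul0r addr0.
Qed.

(** By monotonicity, compare with an underdamped point to the right of [p] and an overdamped one to
    the left. *)
Lemma exp_log_bound_c_bounds p : 0 < p -> pi^-1 < expR (log_bound_c p) < 2^-1.
Proof.
move=> p0; apply/andP; split.
  have h : p < 1 + Num.sqrt (1 + p) ^+ 2 by rewrite sqr_sqrtr; lra.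
  have s0 : 0 < Num.sqrt (1 + p) by rewrite sqrtr_gt0; lra.
  apply: lt_trans (exp_under_c_gt s0) _.
  by rewrite ltr_expR -log_bound_c_under//; exact: log_bound_c_lt.
pose x := Num.min (p / 2) (1 / 2).
have x0 : 0 < x by rewrite lt_min !divr_gt0.
have xp : x <= p / 2 by rewrite ge_min lexx.
have x1 : x <= 1 / 2 by rewrite ge_min lexx orbT.
have hx : 0 < Num.sqrt (1 - x) < 1 by apply: sqrt_over; lra.
apply: lt_trans (exp_over_c_lt hx); rewrite ltr_expR.
rewrite -log_bound_c_over// sqr_sqrtr ?subKr; last lra.
by apply: log_bound_c_lt => //; lra.
Qed.

Lemma bound_c_bound_b b c : 0 < b -> 0 < c ->
  4 / c * expR (log_bound_c (4 * b / c ^+ 2)) =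
  2 / Num.sqrt b * expR (log_bound_b (4 * b / c ^+ 2)).
Proof.
move=> b0 c0; have p0 : 0 < 4 * b / c ^+ 2 by rewrite divr_gt0 ?mulr_gt0 ?exprn_gt0.
have s0 : 0 < Num.sqrt b by rewrite sqrtr_gt0.
have pE : 4 * b / c ^+ 2 = (2 * Num.sqrt b / c) ^+ 2.
  by rewrite -{1}(sqr_sqrtr (ltW b0)); field; rewrite gt_eqF.
have q0 : 0 < 2 * Num.sqrt b / c by rewrite divr_gt0// mulr_gt0.
have lE : ln (4 * b / c ^+ 2) / 2 = ln (2 * Num.sqrt b / c).
  by rewrite pE lnXn// -[_ *+ 2]mulr_natr mulfK.
rewrite log_bound_bE// expRD lE lnK//.
by field; rewrite !gt_eqF.
Qed.

(** In units of [c / 2], the decay rates are [1 - Delta] and [1 + Delta] when overdamped; when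
    underdamped, the rate is 1 and the frequency Delta. *)
Lemma optimal_bound b c : 0 < b -> 0 < c ->
  is_optimal_bound b c (4 / c * expR (log_bound_c (4 * b / c ^+ 2))).
Proof.
move=> b0 c0; pose p := 4 * b / c ^+ 2.
have p0 : 0 < p by rewrite divr_gt0 ?mulr_gt0 ?exprn_gt0.
have bE : b = (c / 2) ^+ 2 * p by rewrite /p; field; rewrite gt_eqF.
have a0 : 0 < c / 2 by rewrite divr_gt0.
rewrite -/p /log_bound_c; case: (ltgtP p 1) => p1.
- have hx : 0 < Num.sqrt (1 - p) < 1 by apply: sqrt_over; rewrite p0.
  have pE : p = 1 - Num.sqrt (1 - p) ^+ 2 by rewrite sqr_sqrtr ?subKr// subr_ge0 ltW.
  move: (Num.sqrt _) hx pE => x /[dup] hx /andP[x0 x1] pE.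
  have l0 : 0 < c / 2 * (1 - x) by rewrite mulr_gt0// subr_gt0.
  have l1 : c / 2 * (1 - x) < c / 2 * (1 + x) by rewrite ltr_pM2l//; lra.
  have := overdamped_optimal l0 l1.
  have -> : c / 2 * (1 - x) * (c / 2 * (1 + x)) = b by rewrite bE pE; ring.
  have -> : c / 2 * (1 - x) + c / 2 * (1 + x) = c by field.
  have -> : c / 2 * (1 + x) / (c / 2 * (1 - x)) = (1 + x) / (1 - x).
    by field; rewrite !gt_eqF//; lra.
  rewrite ln_div ?posrE; [|lra|lra].
  set l := ln (1 + x) - ln (1 - x).
  suff -> : 2 * (expR (- (c / 2 * (1 - x) * (l / (c / 2 * (1 + x) - c / 2 * (1 - x))))) /
    (c / 2 * (1 + x))) = 4 / c * expR (over_c x) by [].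
  have -> : c / 2 * (1 - x) * (l / (c / 2 * (1 + x) - c / 2 * (1 - x))) = (1 - x) / (2 * x) * l.
    by field; rewrite !gt_eqF//; lra.
  rewrite over_cE// -/l expRD expRN (expRN (ln _)) lnK ?posrE; last lra.
  by field; rewrite !gt_eqF ?expR_gt0//; lra.
- have := @underdamped_optimal _ (c / 2) (Num.sqrt (p - 1)) a0.
  rewrite sqrtr_gt0 subr_gt0 => /(_ p1).
  have hx : 0 < Num.sqrt (p - 1) by rewrite sqrtr_gt0 subr_gt0.
  have pE : p = 1 + Num.sqrt (p - 1) ^+ 2 by rewrite sqr_sqrtr ?subr_ge0 ?ltW// addrC subrK.
  move: (Num.sqrt _) hx pE => x x0 pE; rewrite -pE -bE.
  have -> : 2 * (c / 2) = c by field.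
  rewrite exp_under_c//  -pE.
  suff -> : 2 * (expR (- (atan x / x)) / (c / 2 * Num.sqrt p)) / osc_ratio x =
    4 / c * ((osc_ratio x * Num.sqrt p)^-1 * expR (- (atan x / x))) by [].
  by field; rewrite !gt_eqF// ?sqrtr_gt0// osc_ratio_gt0.
- have := critical_optimal a0.
  have -> : (c / 2) ^+ 2 = b by rewrite bE p1 mulr1.
  have -> : 2 * (c / 2) = c by field.
  suff -> : 2 * (expR (- 1) / (c / 2)) = 4 / c * expR (-1) by [].
  by field; rewrite gt_eqF.
Qed.

End DampingProfiles.

Theorem theorem3p1 (R : realType) :
  let K : R -> R -> R := optimal_velocity_bound in
  (forall b c : R, 0 < b -> 0 < c ->
     (* the infimum defining K b c is a minimum *)
     (velocity_bound b c (K b c) /\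
      forall k : R, velocity_bound b c k -> K b c <= k) /\
     let D := Num.sqrt `|1 - 4 * b / c ^+ 2| in
     [/\ 4 * b < c ^+ 2 ->
           K b c = 2 / Num.sqrt b * ((1 - D) / (1 + D)) `^ (1 / (2 * D)),
         4 * b = c ^+ 2 ->
           K b c = 4 / (expR 1 * c) &
         c ^+ 2 < 4 * b ->
           K b c = 2 / Num.sqrt b * (1 - expR (- (pi / D)))^-1
                   * expR (- (atan D / D))]) /\
  (forall c : R, 0 < c -> forall b1 b2 : R, 0 < b1 -> b1 < b2 ->
     K b2 c < K b1 c) /\
  (forall b : R, 0 < b -> forall c1 c2 : R, 0 < c1 -> c1 < c2 ->
     K b c2 < K b c1) /\
  (forall b c : R, 0 < b -> 0 < c -> 4 / (pi * c) < K b c < 2 / c) /\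
  (forall k : R, (forall b c : R, 0 < b -> 0 < c -> K b c < k / c) ->
     2 <= k) /\
  (forall k : R, (forall b c : R, 0 < b -> 0 < c -> k / c < K b c) ->
     k <= 4 / pi).
Proof.
move=> K.
have KE b c : 0 < b -> 0 < c -> K b c = 4 / c * expR (log_bound_c (4 * b / c ^+ 2)).
  by move=> b0 c0; exact/optimal_velocity_boundE/optimal_bound.
have KE' b c : 0 < b -> 0 < c -> K b c = 2 / Num.sqrt b * expR (log_bound_b (4 * b / c ^+ 2)).
  by move=> b0 c0; rewrite KE// bound_c_bound_b.
have p0 : 0 < pi :> R := pi_gt0 R.
split=> [b c b0 c0|].
  split; first by have := optimal_bound b0 c0; rewrite -KE.
  have c2 : 0 < c ^+ 2 by rewrite exprn_gt0.
  move=> D; split=> h.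
  - have p1 : 4 * b / c ^+ 2 < 1 by rewrite ltr_pdivrMr// mul1r.
    have DE : D = Num.sqrt (1 - 4 * b / c ^+ 2) by rewrite /D gtr0_norm// subr_gt0.
    have /andP[D0 D1] : 0 < D < 1.
      by rewrite DE; apply: sqrt_over; rewrite p1 divr_gt0// mulr_gt0.
    rewrite KE'// /log_bound_b p1 -DE /powR gt_eqF; last by rewrite divr_gt0//; lra.
    congr (_ * expR _); rewrite /over_b /artanh ln_div ?posrE; [|lra|lra].
    by field; rewrite gt_eqF.
  - rewrite KE// h divff ?gt_eqF// /log_bound_c ltxx eqxx expRN.
    by field; rewrite !gt_eqF ?expR_gt0.
  - have p1 : 1 < 4 * b / c ^+ 2 by rewrite ltr_pdivlMr// mul1r.
    have DE : D = Num.sqrt (4 * b / c ^+ 2 - 1) by rewrite /D distrC gtr0_norm// subr_gt0.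
    have D0 : 0 < D by rewrite DE sqrtr_gt0 subr_gt0.
    rewrite KE'// /log_bound_b ltNge (ltW p1) /= gt_eqF// -DE /under_b expRD.
    by rewrite expRN lnK ?posrE ?osc_ratio_gt0// mulrA.
split=> [c c0 b1 b2 b10 b12|].
  have b20 := lt_trans b10 b12.
  rewrite !KE// ltr_pM2l ?divr_gt0// ltr_expR log_bound_c_lt//.
    by rewrite divr_gt0 ?mulr_gt0 ?exprn_gt0.
  by rewrite ltr_pM2r ?invr_gt0 ?exprn_gt0// ltr_pM2l.
split=> [b b0 c1 c2 c10 c12|].
  have c20 := lt_trans c10 c12.
  rewrite !KE'// ltr_pM2l ?divr_gt0 ?sqrtr_gt0// ltr_expR log_bound_b_lt//.
    by rewrite divr_gt0 ?mulr_gt0 ?exprn_gt0.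
  rewrite ltr_pM2l ?mulr_gt0// ltf_pV2 ?posrE ?exprn_gt0//.
  by rewrite ltr_pXn2r// nnegrE ltW.
split=> [b c b0 c0|].
  rewrite KE//; have /andP[l u] : pi^-1 < expR (log_bound_c (4 * b / c ^+ 2)) < 2^-1.
    by apply: exp_log_bound_c_bounds; rewrite divr_gt0 ?mulr_gt0 ?exprn_gt0.
  have -> : 4 / (pi * c) = 4 / c / pi by rewrite invfM; ring.
  have -> : 2 / c = 4 / c * 2^-1 by field; rewrite gt_eqF.
  by rewrite !ltr_pM2l ?divr_gt0// l u.
split=> [k kP|k kP]; rewrite leNgt; apply/negP => hk.
  (* With [c = 1] and [b = (1 - x^2) / 4] one has Delta equal to [x], and
     [K > 4 (1 / 2 - (2 - k) / 4) = k]. *)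
  have e0 : 0 < (2 - k) / 4 by rewrite divr_gt0// subr_gt0.
  have [x hx xk] := exp_over_c_lower e0.
  have x2 : 0 < 1 - x ^+ 2 by nra.
  have := kP ((1 - x ^+ 2) / 4) 1 (divr_gt0 x2 (ltr0Sn _ 3)) ltr01.
  rewrite KE// ?divr_gt0// expr1n !divr1 [4 * (_ / 4)]mulrC divfK ?pnatr_eq0//.
  by rewrite log_bound_c_over//; lra.
have e0 : 0 < k - 4 / pi by rewrite subr_gt0.
(* Chosen so that the upper bound [4 (1 / pi + 1 / d)] on [K], for [c = 1] and Delta equal to [d],
   is exactly [k]. *)
pose d := 4 / (k - 4 / pi); have d0 : 0 < d by rewrite divr_gt0.
have d2 : 0 < 1 + d ^+ 2 by have := sqr_ge0 d; lra.
have := kP ((1 + d ^+ 2) / 4) 1 (divr_gt0 d2 (ltr0Sn _ 3)) ltr01.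
rewrite KE// ?divr_gt0// expr1n !divr1 [4 * (_ / 4)]mulrC divfK ?pnatr_eq0//.
rewrite log_bound_c_under//; have := exp_under_c_upper d0.
have -> : d^-1 = (k - 4 / pi) / 4 by rewrite /d invf_div.
lra.
Qed.
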